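(* Let $(\mathcal N,\mathcal O,\mathfrak l)$, $\mathcal O=\mathcal O(I)$, be an acyclically oriented plabic network which possesses neither internal sources nor internal sinks and represents a point in an irreducible positroid cell. Then all edge vectors $E_e$ (both the internal and the boundary ones) are non-null. Moreover, for every edge $e$, $$E_e=\sum_{j\in\bar I}\Big(\sum_{F\in\mathcal F_{e,b_j}(\mathcal G)}(-1)^{\mathrm{wind}(F)+\mathrm{int}(F)}w(F)\Big)E_j=\sum_{j\in\bar I}\Big((-1)^{\sigma(e,b_j)}\sum_{F\in\mathcal F_{e,b_j}(\mathcal G)}w(F)\Big)E_j,$$ where $E_j$ is the $j$-th vector of the canonical basis of $\mathbb R^n$, $\bar I=[n]\setminus I$, the sum runs over the set $\mathcal F_{e,b_j}(\mathcal G)$ of all directed paths $F$ starting at $e$ and ending at $b_j$, and $\sigma(e,b_j)$ (the parity of $\mathrm{wind}(F)+\mathrm{int}(F)$) is the same for all such $F$. In particular this formula holds for all edges of Le-networks representing points in irreducible positroid cells.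
   Context: $Gr^{\mathrm{TNN}}(k,n)=GL_k^+\backslash Mat^{\mathrm{TNN}}_{k,n}$, where $Mat^{\mathrm{TNN}}_{k,n}$ is the set of real $k\times n$ matrices of rank $k$ with non-negative maximal minors $\Delta_J$. For a matroid $\mathcal M$, the positroid cell is $\mathcal S^{\mathrm{TNN}}_{\mathcal M}=\{[A]:\Delta_J(A)>0\text{ if }J\in\mathcal M,\ \Delta_J(A)=0\text{ if }J\notin\mathcal M\}$; it is irreducible if for every $j\in[n]$ there exist $J,J'\in\mathcal M$ with $j\in J$, $j\notin J'$. Fix positive integers $k<n$. A plabic graph $\mathcal G$ of type $(k,n)$ is a finite directed graph drawn planarly in a disk, with no component isolated from the boundary, such that: it has $n$ boundary vertices $b_1,\dots,b_n$ labelled clockwise, all on a common straight interval of the boundary of the disk, each of degree 1 (a boundary source if its edge is outgoing, a boundary sink if incoming; exactly $k$ are sources); all other (internal) vertices are strictly inside the disk and are bivalent or trivalent; each internal vertex either has exactly one incoming edge (white) or exactly one outgoing edge (black), bivalent vertices being assigned either colour. Edges are straight segments, regarded as vectors directed by the orientation $\mathcal O$. $I=\{i_1<\dots<i_k\}$ indexes the boundary sources. A plabic network $\mathcal N$ is a plabic graph with a positive weight $w_e$ on each edge. The orientation is acyclic if there are no directed cycles. $\mathcal N$ represents $[A]$ if $[A]$ is the class of the matrix with identity submatrix in the columns $I$ and entries $A^r_j=(-1)^{\sigma(i_r,j)}\sum_{P:b_{i_r}\to b_j}(-1)^{\mathrm{wind}_{top}(P)}w(P)$ for $j\in\bar I$,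 where $\sigma(i_r,j)$ is the number of elements of $I$ strictly between $i_r$ and $j$, the sum is over directed walks and $\mathrm{wind}_{top}$ is the topological winding index (it is even for all walks of an acyclic network). A gauge ray direction $\mathfrak l$ is an oriented direction such that the ray in direction $\mathfrak l$ from any boundary vertex points inside the disk, no internal edge is parallel to $\mathfrak l$, and the rays starting at boundary vertices contain no internal vertices. $\mathfrak l_i$ is the ray starting at $b_i$. For plane vectors $s(u,v)=+1,0,-1$ if $(u,v)$ is positively (counterclockwise) oriented, parallel, negatively oriented. For consecutive edges, $\mathrm{wind}(e,f)=\pm1$ if $s(e,f)=s(e,\mathfrak l)=s(\mathfrak l,f)=\pm1$, and $0$ otherwise. $\mathrm{int}(e)$ is the number of intersections of $e$ with the rays $\mathfrak l_{i_r}$, $r\in[k]$ (the common starting point of $\mathfrak l_{i_r}$ and the edge at $b_{i_r}$ is not counted). For a directed path $\mathcal P=(e_1,\dots,e_m)$: $w(\mathcal P)=\prod w_{e_l}$, $\mathrm{wind}(\mathcal P)=\sum_{l=1}^{m-1}\mathrm{wind}(e_l,e_{l+1})$, $\mathrm{int}(\mathcal P)=\sum_{l=1}^m\mathrm{int}(e_l)$. The edge vector $E_e\in\mathbb R^n$ has components $(E_e)_j=\sum_{\mathcal P:e\to b_j}(-1)^{\mathrm{wind}(\mathcal P)+\mathrm{int}(\mathcal P)}w(\mathcal P)$, the sum over all directed paths with first edge $e$ ending at $b_j$ (zero if there is none). Le-networks. A Le-diagram is a filling by $0$'s and $1$'s of a Young diagram contained in a $k\times(n-k)$ rectangle such that a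 box having a $1$ above it in its column and a $1$ to its left in its row contains a $1$. Label the steps of the south-east border path $1,\dots,n$ from the north-east to the south-west corner; boundary vertices are on these steps, those on vertical steps being sources and those on horizontal steps sinks. From each box containing $1$ draw a vertex, a horizontal line to the right up to the border and a vertical line down to the border; orient horizontal edges leftwards and vertical edges downwards. The plabic Le-graph is obtained by replacing each vertex having four edges with a black trivalent vertex (receiving the edges from the right and from above) joined by an edge to a white trivalent vertex (emitting the edges to the left and downwards); other vertices become bivalent, trivalent white (in: right; out: left, down) or trivalent black (in: right, above; out: down). A Le-network is such a graph with positive edge weights and this canonical (acyclic) orientation. *)

(* Defs.v *)
(* MathComp-Analysis; the real numbers are an arbitrary [R : realType]. *)
From mathcomp Require Import all_boot all_order all_algebra.
From mathcomp Require Import zify.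
From mathcomp Require Import all_classical all_reals all_analysis.
Import Order.TTheory GRing.Theory Num.Theory.
Import numFieldNormedType.Exports.

Set Implicit Arguments.
Unset Strict Implicit.
Unset Printing Implicit Defensive.

Local Open Scope classical_set_scope.
Local Open Scope ring_scope.

Section Plane.
Context {R : realType}.
Implicit Types u v p q : R * R.

Definition cross u v : R := u.1 * v.2 - u.2 * v.1.
Definition dot u v : R := u.1 * v.1 + u.2 * v.2.

Definition segment p q : set (R * R) :=
  [set p + t *: (q - p) | t in [set t : R | 0 <= t <= 1]].
Definition open_segment p q : set (R * R) :=
  [set p + t *: (q - p) | t in [set t : R | 0 < t < 1]].

(* By the Schoenflies theorem every closed topological disk in the plane is
   the image of the round one under a homeomorphism of the whole plane. *)
Definition closed_disk (D : set (R * R)) :=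
  exists phi psi : R * R -> R * R,
    [/\ continuous phi, continuous psi, cancel phi psi, cancel psi phi
      & D = phi @` [set p | p.1 ^+ 2 + p.2 ^+ 2 <= 1]].

(* [orient u v] is +1 iff (u, v) is counterclockwise. *)
Definition orient u v : int := sgz (cross u v).

Definition wind2 (l u v : R * R) : int :=
  if (orient u v == orient u l) && (orient u l == orient l v) then orient u v
  else 0.

(* Oriented angle in ]-pi, pi[ from u to v (0 if u, v are opposite, which does
   not happen for consecutive edges of a plane graph). *)
Definition turn u v : R :=
  Num.sg (cross u v)
  * acos (dot u v / (Num.sqrt (dot u u) * Num.sqrt (dot v v))).

End Plane.

Definition sum_consecutive (T : Type) (V : nmodType) (f : T -> T -> V)
  (x : seq T) : V := \sum_(ab <- zip x (behead x)) f ab.1 ab.2.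

(* A directed graph with boundary vertices [inl i], i : 'I_n, its drawing with
   straight edges, and a region of the plane. *)
Record drawing (R : realType) (n : nat) := Drawing {
  ivertex : finType;
  edge : finType;
  src : edge -> 'I_n + ivertex;
  tgt : edge -> 'I_n + ivertex;
  white : pred ivertex;
  pos : 'I_n + ivertex -> R * R;
  disk : set (R * R)
}.

Section Drawing.
Context {R : realType} {n : nat} (G : drawing R n).
Implicit Types (e f : edge G) (x : 'I_n + ivertex G) (P : seq (edge G)).

Definition in_degree x : nat := #|[set e : edge G | tgt e == x]%SET|.
Definition out_degree x : nat := #|[set e : edge G | src e == x]%SET|.
Definition degree x : nat := in_degree x + out_degree x.

(* The set I of (indices of) boundary sources. *)
Definition sources : {set 'I_n} := [set i | out_degree (inl i) == 1%N]%SET.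

Definition adjacent : rel ('I_n + ivertex G)%type :=
  [rel x y | [exists e : edge G, ((src e == x) && (tgt e == y))
                                 || ((src e == y) && (tgt e == x))]].

Definition evec e : R * R := pos (tgt e) - pos (src e).
Definition eseg e : set (R * R) := segment (pos (src e)) (pos (tgt e)).

Definition planar_drawing :=
  [/\ injective (@pos R n G),
      forall e, src e <> tgt e,
      forall e x, eseg e (pos x) -> x = src e \/ x = tgt e
    & forall e f p, e <> f -> eseg e p -> eseg f p ->
        exists x, [/\ p = pos x, x = src e \/ x = tgt e
                    & x = src f \/ x = tgt f]].

(* The boundary vertices lie on the straight open interval ]p, q[ of the
   boundary of the disk, in this order from p to q; they are labelled clockwise
   because the disk is on the right-hand side of the vector from p to q. *)
Definition straight_clockwise_boundary :=
  exists (p q : R * R) (t : 'I_n -> R),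
    [/\ p <> q,
        forall i, 0 < t i < 1 /\ pos (inl i : 'I_n + ivertex G) = p + t i *: (q - p),
        forall i j : 'I_n, (i < j)%N -> t i < t j
      & forall z, open_segment p q z ->
          \forall y \near z, disk G y <-> cross (q - p) (y - z) <= 0].

Definition drawn_in_disk :=
  [/\ closed_disk (disk G),
      straight_clockwise_boundary,
      forall v : ivertex G, interior (disk G) (pos (inr v))
    & forall e, eseg e `<=` disk G].

Definition follows : rel (edge G) := [rel e f | tgt e == src f].

Definition acyclic :=
  forall e P, path follows e P -> tgt (last e P) <> src e.

Definition no_internal_source := forall v : ivertex G, (0 < in_degree (inr v))%N.
Definition no_internal_sink := forall v : ivertex G, (0 < out_degree (inr v))%N.

Definition paths (e : edge G) (j : 'I_n) : set (seq (edge G)) :=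
  [set P | [/\ ohead P = Some e, sorted follows P & tgt (last e P) = inl j]].

Definition walks (i j : 'I_n) : set (seq (edge G)) :=
  [set P | exists2 e, src e = inl i & paths e j P].

(* The ray starting at b_i, without b_i itself. *)
Definition open_ray (l : R * R) (i : 'I_n) : set (R * R) :=
  [set pos (inl i : 'I_n + ivertex G) + t *: l | t in [set t : R | 0 < t]].

Definition gauge_ray_direction (l : R * R) :=
  [/\ l <> 0,
      forall i, \forall t \near 0^'+,
        interior (disk G) (pos (inl i : 'I_n + ivertex G) + t *: l),
      forall e (u v : ivertex G), src e = inr u -> tgt e = inr v ->
        orient (evec e) l <> 0
    & forall i (v : ivertex G), ~ open_ray l i (pos (inr v))].

Definition wind (l : R * R) P : int :=
  sum_consecutive (fun e f => wind2 l (evec e) (evec f)) P.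

(* The gauge conditions and planarity imply that an edge meets a ray in at most
   one point, so intersections are counted by the rays which are met. *)
Definition int_edge (l : R * R) e : nat :=
  #|[set i in sources | `[< eseg e `&` open_ray l i !=set0 >]]%SET|.
Definition int_path (l : R * R) P : nat := \sum_(e <- P) int_edge l e.

(* Number of full turns of the tangent vector along a walk from b_i to b_j, the
   initial and final tangent vectors being made parallel to b_j - b_i. *)
Definition wind_top (i j : 'I_n) P : int :=
  let d := pos (inl j : 'I_n + ivertex G) - pos (inl i : 'I_n + ivertex G) in
  Num.floor (sum_consecutive turn (d :: rcons (map evec P) d) / (2 * pi)).

End Drawing.

Record plabic_graph (R : realType) (k n : nat) := PlabicGraph {
  pdrawing :> drawing R n;
  planar_pdrawing : planar_drawing pdrawing;
  pdrawn_in_disk : drawn_in_disk pdrawing;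
  boundary_degree : forall i, degree (G := pdrawing) (inl i) = 1%N;
  card_sources : #|sources pdrawing| = k;
  internal_degree : forall v, degree (G := pdrawing) (inr v) \in [:: 2; 3]%N;
  internal_color : forall v,
    if @white R n pdrawing v then in_degree (G := pdrawing) (inr v) = 1%N
    else out_degree (G := pdrawing) (inr v) = 1%N;
  not_isolated : forall v, exists i,
    connect (adjacent (G := pdrawing)) (inr v) (inl i)
}.

Record plabic_network (R : realType) (k n : nat) := PlabicNetwork {
  pgraph :> plabic_graph R k n;
  weight : edge pgraph -> R;
  weight_gt0 : forall e, 0 < weight e
}.

Section Network.
Context {R : realType} {k n : nat} (N : plabic_network R k n).

Definition path_weight (P : seq (edge N)) : R := \prod_(e <- P) weight e.

(* The sums over directed paths or walks below are sums over a classical set;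
   for acyclic networks this set is finite. *)
Definition edge_vector (l : R * R) (e : edge N) : 'rV[R]_n :=
  \row_j \sum_(P \in paths e j)
           (-1) ^ (wind l P + (int_path l P)%:Z) * path_weight P.

Definition source (r : 'I_k) : 'I_n :=
  enum_val (cast_ord (esym (card_sources N)) r).

Definition sigma_between (i j : 'I_n) : nat :=
  #|[set m in sources N | (i < m < j)%N || (j < m < i)%N]%SET|.

Definition boundary_matrix : 'M[R]_(k, n) :=
  \matrix_(r < k, j < n)
    if j \in sources N then (source r == j)%:R
    else (-1) ^+ sigma_between (source r) j *
         \sum_(P \in walks (G := N) (source r) j)
            (-1) ^ wind_top (source r) j P * path_weight P.

(* [A] and [boundary_matrix] have the same class modulo GL_k^+. *)
Definition represents (A : 'M[R]_(k, n)) :=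
  exists2 g : 'M[R]_k, 0 < \det g & A = g *m boundary_matrix.

End Network.

Section Positroid.
Context {R : realType} {k n : nat}.
Implicit Types (A : 'M[R]_(k, n)) (M : {set {set 'I_n}}) (J : {set 'I_n}).

(* The maximal minor with columns J, in increasing order ([#|J| = k]). *)
Definition minor A J : R :=
  \det (\matrix_(r < k, c < k) [seq A r j | j <- enum J]`_c).

Definition mat_tnn A :=
  \rank A = k /\ forall J, #|J| = k -> 0 <= minor A J.

(* A matroid of rank k on [n], given by its set of bases. *)
Definition matroid M :=
  [/\ exists J, J \in M,
      forall J, J \in M -> #|J| = k
    & forall J J' j, J \in M -> J' \in M -> j \in J -> j \notin J' ->
        exists2 j', (j' \in J') && (j' \notin J) & (j' |: (J :\ j))%SET \in M].

Definition positroid_cell M A :=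
  mat_tnn A /\
  forall J, #|J| = k ->
    (J \in M -> 0 < minor A J) /\ (J \notin M -> minor A J = 0).

Definition irreducible_cell M :=
  forall j : 'I_n,
    (exists2 J, J \in M & j \in J) /\ (exists2 J, J \in M & j \notin J).

End Positroid.

(* Boxes (r, c) are numbered from 0, rows from top to bottom and columns from
   left to right; row r of the diagram has [le_shape r] boxes, and [le_fill] is
   the set of boxes filled with 1. *)
Record le_diagram (k n : nat) := LeDiagram {
  le_kn : (k <= n)%N;
  le_shape : 'I_k -> nat;
  le_shape_noninc : forall r r' : 'I_k, (r <= r')%N -> (le_shape r' <= le_shape r)%N;
  le_shape_le : forall r, (le_shape r <= n - k)%N;
  le_fill : 'I_k -> 'I_(n - k) -> bool;
  le_fill_in : forall r c, le_fill r c -> (c < le_shape r)%N;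
  le_property : forall (r r' : 'I_k) (c c' : 'I_(n - k)),
    (c < le_shape r)%N -> (r' < r)%N -> (c' < c)%N ->
    le_fill r' c -> le_fill r c' -> le_fill r c
}.

Section LeGraph.
Context {k n : nat} (L : le_diagram k n).

(* The label of the vertical step in row r: it is preceded on the border path
   by r vertical steps and by the horizontal steps of the columns c with
   [le_shape r <= c]. *)
Lemma le_row_label_subproof (r : 'I_k) :
  (r + (n - k - le_shape L r) < n)%N.
Proof. have := le_kn L; have := ltn_ord r; lia. Qed.

Definition le_row_label (r : 'I_k) : 'I_n := Ordinal (le_row_label_subproof r).

(* The label of the horizontal step in column c: it is preceded by the vertical
   steps of the rows which meet column c and by the horizontal steps of the
   columns on the right of c. *)
Lemma le_col_label_subproof (c : 'I_(n - k)) :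
  (#|[set r : 'I_k | (c < le_shape L r)%N]%SET| + (n - k - c.+1) < n)%N.
Proof.
set h := #|_|; have hk : (h <= k)%N by rewrite -[leqRHS]card_ord max_card.
by have := le_kn L; have := ltn_ord c; lia.
Qed.

Definition le_col_label (c : 'I_(n - k)) : 'I_n :=
  Ordinal (le_col_label_subproof c).

Definition le_box := {b : 'I_k * 'I_(n - k) | le_fill L b.1 b.2}.
Definition le_row (b : le_box) : 'I_k := (val b).1.
Definition le_col (b : le_box) : 'I_(n - k) := (val b).2.

Definition right_of (b b' : le_box) : bool :=
  (le_row b' == le_row b) && (le_col b < le_col b')%N.
Definition below (b b' : le_box) : bool :=
  (le_col b' == le_col b) && (le_row b < le_row b')%N.

Definition next_right (b : le_box) : option le_box :=
  [pick b' | right_of b b'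
             & [forall b'' : le_box, ~~ (right_of b b'' && right_of b'' b')]].
Definition next_below (b : le_box) : option le_box :=
  [pick b' | below b b'
             & [forall b'' : le_box, ~~ (below b b'' && below b'' b')]].

(* The vertex drawn in b has four edges. *)
Definition four_valent (b : le_box) : bool :=
  [exists b' : le_box, right_of b' b] && [exists b' : le_box, below b' b].

(* [(b, false)] receives the edges from the right and from above, [(b, true)]
   emits the edges to the left and downwards; they are merged into [(b, false)]
   unless b is four-valent. *)
Definition le_vertex := {v : le_box * bool | v.2 ==> four_valent v.1}.

Definition le_in (b : le_box) : le_vertex := exist _ (b, false) isT.
Definition le_out (b : le_box) : le_vertex :=
  exist _ (b, four_valent b) (implybb (four_valent b)).

(* The horizontal edge arriving in b from the right, the vertical edge leaving b
   downwards, and the edge joining the two vertices of a four-valent b. *)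
Inductive le_edge :=
| LeHorizontal of le_box
| LeVertical of le_box
| LeMiddle of {b : le_box | four_valent b}.

Definition le_src (e : le_edge) : 'I_n + le_vertex :=
  match e with
  | LeHorizontal b => if next_right b is Some b' then inr (le_out b')
                      else inl (le_row_label (le_row b))
  | LeVertical b => inr (le_out b)
  | LeMiddle b => inr (le_in (val b))
  end.

Definition le_tgt (e : le_edge) : 'I_n + le_vertex :=
  match e with
  | LeHorizontal b => inr (le_in b)
  | LeVertical b => if next_below b is Some b' then inr (le_in b')
                    else inl (le_col_label (le_col b))
  | LeMiddle b => inr (le_out (val b))
  end.

End LeGraph.

(* The directed graph of N is isomorphic to a Le-graph, with the same labels of
   the boundary vertices. *)
Definition le_network (R : realType) (k n : nat) (N : plabic_network R k n) :=
  exists (L : le_diagram k n) (fV : le_vertex L -> ivertex N)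
         (fE : le_edge L -> edge N),
    let f x := match x with inl i => inl i | inr v => inr (fV v) end in
    [/\ bijective fV, bijective fE,
        forall e, src (fE e) = f (le_src e)
      & forall e, tgt (fE e) = f (le_tgt e)].

(* Main.v *)
(* Every directed path from an edge e to b_j extends backwards, through a fixed
   path, to a simple path W from some boundary source b_i to b_j, so it suffices
   to control wind(W) and int(W) modulo 2.  Replacing the tangent direction of W
   by the direction of its secants (Hopf's proof of the Umlaufsatz, modulo 2),
   wind(W) becomes the number of edges of W above b_i plus the number of edges of
   W below b_j, while int(W) is a sum over the boundary sources b_r of the number
   of edges of W above b_r, "above" referring to the direction of the rays.  For
   two such paths with common first and last edges, the remaining edges form a
   closed polygon inside the disk that avoids the boundary vertices; each boundary
   vertex is joined to infinity outside the disk, so the number of edges of this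
   polygon above, or below, a boundary vertex is even. *)
Require Import Defs.
From mathcomp Require Import all_boot all_order all_algebra.
From mathcomp Require Import all_classical all_reals all_analysis.
From mathcomp Require Import ring lra zify.
Import Order.TTheory GRing.Theory Num.Theory.
Import numFieldNormedType.Exports.
Local Open Scope classical_set_scope.
Local Open Scope ring_scope.

(** * Crossing parity of polygonal lines *)

Section PlaneSegments.
Context {R : realType}.
Implicit Types (a b c d z w : R * R) (s : seq (R * R)) (x M : R).

(** Ordinate over [x] on the line through [a] and [b]. If [a.1 = b.1], the division by zero makes it
    constantly [a.2], so it is symmetric in [a] and [b] only for non-vertical lines. *)
Definition yat a b x : R := a.2 + (x - a.1) * ((b.2 - a.2) / (b.1 - a.1)).

Lemma yatC a b x : a.1 != b.1 -> yat a b x = yat b a x.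
Proof.
move=> ab; rewrite /yat; field.
by rewrite !subr_eq0 ab eq_sym ab.
Qed.

Lemma yat_l a b : yat a b a.1 = a.2.
Proof. by rewrite /yat subrr mul0r addr0. Qed.

Lemma yat_r a b : a.1 != b.1 -> yat a b b.1 = b.2.
Proof. by move=> ab; rewrite yatC // yat_l. Qed.

Lemma pair_affine a b t :
  a + t *: (b - a) = (a.1 + t * (b.1 - a.1), a.2 + t * (b.2 - a.2)).
Proof. by case: a b => [a1 a2] [b1 b2]. Qed.

Lemma segment_sym a b : segment a b = segment b a.
Proof.
have sub c d : segment c d `<=` segment d c.
  move=> _ [t /andP[t0 t1] <-]; exists (1 - t); first by apply/andP; split; lra.
  by rewrite !pair_affine; congr pair; ring.
by apply/seteqP.
Qed.

Lemma yat_on_segment a b x : a.1 < b.1 -> a.1 <= x <= b.1 ->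
  segment a b (x, yat a b x).
Proof.
move=> ab /andP[ax xb]; have ba0 : 0 < b.1 - a.1 by rewrite subr_gt0.
exists ((x - a.1) / (b.1 - a.1)).
  by apply/andP; split; rewrite ?divr_ge0 ?ler_pdivrMr //; lra.
by rewrite pair_affine /yat; congr pair; field; rewrite gt_eqF.
Qed.

Lemma segment_yat a b z : a.1 < b.1 -> segment a b z ->
  a.1 <= z.1 <= b.1 /\ z.2 = yat a b z.1.
Proof.
move=> ab [t /andP[t0 t1] <-]; rewrite pair_affine /yat /=.
split; first by apply/andP; split; nra.
by field; rewrite subr_eq0 gt_eqF.
Qed.

(* Half-open ranges amount to moving z slightly to the right, away from the
   vertical lines through a and b. *)
Definition under z a b : bool :=
  ((a.1 <= z.1 < b.1) || (b.1 <= z.1 < a.1)) && (z.2 < yat a b z.1).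

Lemma underC z a b : under z a b = under z b a.
Proof.
(* A vertical segment has an empty half-open range, so the asymmetry of [yat] is harmless. *)
rewrite /under orbC; case: (eqVneq a.1 b.1) => [ab|/yatC->//].
by rewrite ab le_lt_asym.
Qed.

(* The jump of the half-open conventions at an end c lying above z0; it is the same
   for all segments ending at c, so it cancels along a polygonal line. *)
Definition shadow z0 c z : bool :=
  [&& c.1 == z0.1, z0.2 < c.2 & z.1 < c.1].

Lemma continuous_fst z0 : (fun z : R * R => z.1) @ z0 --> z0.1.
Proof. exact: cvg_fst. Qed.

Lemma near_fst_lt z0 x : z0.1 < x -> \forall z \near z0, z.1 < x.
Proof. by move=> h; exact: (continuous_fst z0 _ (lt_nbhsl h)). Qed.

Lemma near_fst_gt z0 x : x < z0.1 -> \forall z \near z0, x < z.1.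
Proof. by move=> h; exact: (continuous_fst z0 _ (lt_nbhsr h)). Qed.

Lemma cvg_gap a b z0 :
  (fun z : R * R => yat a b z.1 - z.2) @ z0 --> yat a b z0.1 - z0.2.
Proof.
apply: cvgB; last exact: cvg_snd.
apply: cvgD; first exact: cvg_cst.
apply: cvgM; last exact: cvg_cst.
by apply: cvgB; [exact: cvg_fst | exact: cvg_cst].
Qed.

Lemma near_below_line a b z0 : z0.2 < yat a b z0.1 ->
  \forall z \near z0, z.2 < yat a b z.1.
Proof.
rewrite -subr_gt0 => /lt_nbhsr /(cvg_gap a b z0 _) h.
by near=> z; rewrite -subr_gt0; near: z; exact: h.
Unshelve. all: by end_near.
Qed.

Lemma near_above_line a b z0 : yat a b z0.1 < z0.2 ->
  \forall z \near z0, yat a b z.1 < z.2.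
Proof.
rewrite -subr_lt0 => /lt_nbhsl /(cvg_gap a b z0 _) h.
by near=> z; rewrite -subr_lt0; near: z; exact: h.
Unshelve. all: by end_near.
Qed.

(** Off the segment, [under] can change near [z0] only when the moving point crosses the vertical
    line through an end that lies above [z0]; the two shadows record this. *)
Lemma under_local a b z0 : a.1 != b.1 -> ~ segment a b z0 ->
  \forall z \near z0,
    under z a b (+) under z0 a b = shadow z0 a z (+) shadow z0 b z.
Proof.
wlog ab : a b / a.1 < b.1 => [hw neq|_].
  move: (neq); rewrite neq_lt => /orP[ab|ba]; first exact: hw.
  rewrite segment_sym => /(hw _ _ ba); rewrite eq_sym => /(_ neq).
  by apply: filterS => z; rewrite !(underC _ b) => ->; rewrite addbC.
have neqab : a.1 != b.1 by rewrite lt_eqF.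
have ba : (b.1 <= a.1) = false by lra.
have un z : under z a b = [&& a.1 <= z.1, z.1 < b.1 & z.2 < yat a b z.1].
  rewrite /under andbA; congr andb; apply/orP/idP => [[]//|]; last by left.
  by move=> /andP[? ?]; apply/andP; split; lra.
move=> off.
have yneq : a.1 <= z0.1 <= b.1 -> z0.2 != yat a b z0.1.
  move=> r; apply: contra_notN off => /eqP e.
  by rewrite (surjective_pairing z0) e; apply: yat_on_segment.
(* Away from the abscissas of the ends both sides vanish. At the abscissa of an end, [z0] is
   strictly below or strictly above that end, and only the first case produces a jump. *)
case: (ltgtP z0.1 a.1) => [lta|gta|ea].
- have ltb : z0.1 < b.1 by lra.
  near=> z; rewrite !un /shadow !(gt_eqF lta) !(gt_eqF ltb) /=.
  have za : z.1 < a.1 by near: z; exact: near_fst_lt.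
  by rewrite !leNgt za lta.
- case: (ltgtP z0.1 b.1) => [ltb|gtb|eb].
  + have := yneq; rewrite !ltW // => /(_ isT); rewrite neq_lt => /orP[lo|hi].
    * near=> z; rewrite !un /shadow (lt_eqF gta) (gt_eqF ltb) /= lo ltb (ltW gta) /=.
      have -> : a.1 <= z.1 by near: z; apply: filterS (near_fst_gt _ _ gta) => z /ltW.
      have -> : z.1 < b.1 by near: z; exact: near_fst_lt.
      have -> : z.2 < yat a b z.1 by near: z; exact: near_below_line.
      by [].
    * near=> z; rewrite !un /shadow (lt_eqF gta) (gt_eqF ltb) /=.
      have hz : yat a b z.1 < z.2 by near: z; exact: near_above_line.
      by rewrite !ltNge !(ltW hz) !(ltW hi) /= !andbF.
  + near=> z; rewrite !un /shadow (lt_eqF gta) (lt_eqF gtb) /=.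
    have zb : b.1 < z.1 by near: z; exact: near_fst_gt.
    by rewrite !ltNge !(ltW zb) !(ltW gtb) !andbF.
  + have nea : a.1 == z0.1 = false by rewrite lt_eqF.
    have := yneq; rewrite eb lexx (ltW ab) => /(_ isT).
    rewrite yat_r // neq_lt => /orP[lo|hi].
    * near=> z; rewrite !un /shadow nea eb ltxx eqxx /= andbF lo addbF /=.
      have -> : a.1 <= z.1 by near: z; apply: filterS (near_fst_gt _ _ gta) => z /ltW.
      have -> : z.2 < yat a b z.1.
        by near: z; apply: near_below_line; rewrite eb yat_r.
      by rewrite andbT.
    * near=> z; rewrite !un /shadow nea eb ltxx /= andbF addbF.
      have hz : yat a b z.1 < z.2.
        by near: z; apply: near_above_line; rewrite eb yat_r.
      by rewrite !ltNge !(ltW hz) !(ltW hi) /= !andbF.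
- have neb : b.1 == z0.1 = false by rewrite gt_eqF // ea.
  have := yneq; rewrite ea lexx (ltW ab) => /(_ isT).
  rewrite yat_l // neq_lt => /orP[lo|hi].
  + near=> z; rewrite !un /shadow neb ea lexx eqxx yat_l lo ab /= addbF.
    have -> : z.1 < b.1 by near: z; apply: near_fst_lt; rewrite ea.
    have -> : z.2 < yat a b z.1.
      by near: z; apply: near_below_line; rewrite ea yat_l.
    by rewrite andbT leNgt; case: (z.1 < a.1).
  + near=> z; rewrite !un /shadow neb ea yat_l.
    have hz : yat a b z.1 < z.2.
      by near: z; apply: near_above_line; rewrite ea yat_l.
    by rewrite !ltNge !(ltW hz) !(ltW hi) /= !andbF.
Unshelve. all: by end_near.
Qed.

Fixpoint crossings z a s : bool :=
  if s is b :: s' then under z a b (+) crossings z b s' else false.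

Fixpoint polyline a s : set (R * R) :=
  if s is b :: s' then segment a b `|` polyline b s' else set0.

Definition nonvertical : rel (R * R) := [rel a b | a.1 != b.1].

(** Each inner vertex contributes its shadow twice, so only the two ends of the line remain. *)
Lemma crossings_local a s z0 : path nonvertical a s -> ~ polyline a s z0 ->
  \forall z \near z0,
    crossings z a s (+) crossings z0 a s
    = shadow z0 a z (+) shadow z0 (last a s) z.
Proof.
elim: s a => [|b s IH] a /=; first by move=> _ _; near=> z; case: (shadow _ _ _).
move=> /andP[ab /IH{}IH] off.
have /IH{}IH : ~ polyline b s z0 by move=> h; apply: off; right.
have /(under_local _ _ _ ab) hab : ~ segment a b z0 by move=> h; apply: off; left.
near=> z; rewrite addbACA.
have -> : under z a b (+) under z0 a b = shadow z0 a z (+) shadow z0 b z.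
  by near: z.
have -> : crossings z b s (+) crossings z0 b s =
          shadow z0 b z (+) shadow z0 (last b s) z by near: z.
by do 3!case: shadow.
Unshelve. all: by end_near.
Qed.

Definition in_box M z := (`|z.1| <= M) && (`|z.2| <= M).

Lemma yat_bounds M a b x : in_box M a -> in_box M b ->
  (a.1 <= x < b.1) || (b.1 <= x < a.1) -> - M <= yat a b x <= M.
Proof.
wlog : a b / a.1 <= x < b.1 => [hw ha hb /orP[h|h]|].
- by apply: hw; rewrite ?h.
- by rewrite yatC; [apply: hw; rewrite ?h | lra].
move=> /andP[ax xb]; rewrite /in_box !ler_norml.
move=> /andP[_ /andP[a2 a2']] /andP[_ /andP[b2 b2']] _.
have ba0 : 0 < b.1 - a.1 by lra.
set t := (x - a.1) / (b.1 - a.1).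
have -> : yat a b x = a.2 + t * (b.2 - a.2) by rewrite /yat /t; field; lra.
have t0 : 0 <= t by rewrite /t divr_ge0; lra.
have t1 : t <= 1 by rewrite /t ler_pdivrMr; lra.
by apply/andP; split; nra.
Qed.

(** Outside the box only points below it can be under the segment. The half-open range is written as
    an exclusive or of two comparisons so that it telescopes along a polygonal line. *)
Lemma under_far M a b z : in_box M a -> in_box M b -> ~~ in_box M z ->
  under z a b = (z.2 < - M) && ((z.1 < a.1) (+) (z.1 < b.1)).
Proof.
move=> ha hb hz; have := yat_bounds M a b z.1 ha hb; rewrite /under.
have -> : (a.1 <= z.1 < b.1) || (b.1 <= z.1 < a.1)
          = (z.1 < a.1) (+) (z.1 < b.1).
  by case: (ltP z.1 a.1) => ?; case: (ltP z.1 b.1) => ? /=;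
    apply/idP/idP; lra.
have [h /(_ isT)/andP[h1 h2]|//] := boolP (_ (+) _); last by rewrite andbF.
rewrite andbT /=.
move: hz; rewrite /in_box negb_and -!ltNge.
case/orP; rewrite ltr_normr => /orP[] h'.
- move: h ha hb; rewrite /in_box !ler_norml.
  move=> h /andP[/andP[? ?] _] /andP[/andP[? ?] _]; move: h.
  have -> : (z.1 < a.1) = false by apply/negbTE; rewrite -leNgt; lra.
  by have -> : (z.1 < b.1) = false by apply/negbTE; rewrite -leNgt; lra.
- move: h ha hb; rewrite /in_box !ler_norml.
  move=> h /andP[/andP[? ?] _] /andP[/andP[? ?] _]; move: h.
  have -> : z.1 < a.1 by lra.
  by have -> : z.1 < b.1 by lra.
- by apply/idP/idP => ?; lra.
- by apply/idP/idP => ?; lra.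
Qed.

Lemma crossings_far M a s z : all (in_box M) (a :: s) -> ~~ in_box M z ->
  crossings z a s = (z.2 < - M) && ((z.1 < a.1) (+) (z.1 < (last a s).1)).
Proof.
elim: s a => [|b s IH] a /=; first by rewrite addbb andbF.
move=> /and3P[ha hb hs] hz; rewrite IH /= ?hb // (under_far M) //.
by case: (z.2 < _); case: (z.1 < a.1); case: (z.1 < b.1); case: (z.1 < _).
Qed.

Lemma boxed s : exists M, all (in_box M) s.
Proof.
elim: s => [|a s [M hM]]; first by exists 0.
exists (Num.max M (Num.max `|a.1| `|a.2|)) => /=.
rewrite {1}/in_box !le_max !lexx !orbT /=.
by apply: sub_all hM => z /andP[h1 h2]; rewrite /in_box !le_max h1 h2.
Qed.

(** The two lines form a closed polygon. Its crossing parity is locally constant off the polygon and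
    zero far away, and [g] joins [g 1] to far away without meeting it. *)
Lemma crossings_eq_at_end a s s' (g : R -> R * R) :
  path nonvertical a s -> path nonvertical a s' -> last a s = last a s' ->
  continuous g ->
  (forall t, 1 <= t -> ~ polyline a s (g t)) ->
  (forall t, 1 <= t -> ~ polyline a s' (g t)) ->
  (forall M, exists2 t, 1 <= t & ~~ in_box M (g t)) ->
  crossings (g 1) a s = crossings (g 1) a s'.
Proof.
move=> ns ns' ll cg offs offs' esc.
pose f z := crossings z a s (+) crossings z a s'.
(* The lines have the same ends, so the jumps given by [crossings_local] cancel in [f]. *)
have floc (t : R) : 1 <= t -> \forall u \near t, f (g u) = f (g t).
  move=> t1.
  have h := crossings_local a s (g t) ns (offs t t1).
  have h' := crossings_local a s' (g t) ns' (offs' t t1).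
  suff : \forall z \near g t, f z = f (g t) by move/(cg t _).
  near=> z.
  have e : crossings z a s (+) crossings (g t) a s =
      shadow (g t) a z (+) shadow (g t) (last a s) z by near: z.
  have e' : crossings z a s' (+) crossings (g t) a s' =
      shadow (g t) a z (+) shadow (g t) (last a s') z by near: z.
  by move: e e'; rewrite /f ll; do 4!case: crossings; do 2!case: shadow.
have [M hM] := boxed (a :: s ++ s').
have [T T1 hT] := esc M.
have fT : f (g T) = false.
  move: hM; rewrite /= all_cat => /and3P[ha hs hs'].
  by rewrite /f !(crossings_far M) ?ll ?addbb //= ?ha.
case f1: (f (g 1)); last by move: f1; rewrite /f; do 2!case: crossings.
(* A continuous function with values 0 and 1 cannot pass from 1 to 0, as it would take the value
   1/2. *)
pose h t : R := (f (g t))%:R.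
have ch : {within `[1, T], continuous h}.
  apply: continuous_in_subspaceT => t; rewrite inE /= in_itv /= => /andP[t1 _].
  apply: cvg_near_cst; near=> u; rewrite /h; congr (nat_of_bool _)%:R.
  by near: u; exact: floc.
have [|c _] := IVT (v := 2^-1) T1 ch.
  by rewrite /h f1 fT /= ge_min le_max; apply/andP; split; apply/orP; [right|left]; lra.
by rewrite /h; case: (f _) => /=; lra.
Unshelve. all: by end_near.
Qed.

End PlaneSegments.

(** * Turning of polygonal lines *)

Section Folds.
Context {R : realType}.
Implicit Types (a b c d z w u v l : R * R).

Definition flipx z : R * R := (- z.1, z.2).
Definition flipy z : R * R := (z.1, - z.2).

Lemma yat_flipx a b x : yat (flipx a) (flipx b) (- x) = yat a b x.
Proof. by rewrite /yat /= -!opprD invrN mulrN mulrNN. Qed.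

Lemma yat_flipy a b x : yat (flipy a) (flipy b) x = - yat a b x.
Proof. by rewrite /yat /= -!opprD mulNr mulrN opprD. Qed.

(* The conventions at the ends of the ranges are opposite: both amount to moving
   the first argument of [upward] to the left of the segment's ends, and the
   first argument of [downward] to their right. *)
Definition upward z a b := under (flipx z) (flipx a) (flipx b).
Definition downward z a b := under (flipy z) (flipy a) (flipy b).

Lemma upwardE z a b : upward z a b =
  ((b.1 < z.1 <= a.1) || (a.1 < z.1 <= b.1)) && (z.2 < yat a b z.1).
Proof.
rewrite /upward /under yat_flipx /= !lerN2 !ltrN2.
by rewrite (andbC (z.1 <= _)) (andbC (z.1 <= b.1)).
Qed.

Lemma downwardE z a b : downward z a b =
  ((a.1 <= z.1 < b.1) || (b.1 <= z.1 < a.1)) && (yat a b z.1 < z.2).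
Proof. by rewrite /downward /under yat_flipy /= ltrN2. Qed.

Lemma upwardC z a b : upward z a b = upward z b a.
Proof. exact: underC. Qed.

Lemma downwardC z a b : downward z a b = downward z b a.
Proof. exact: underC. Qed.

Lemma affine_same_sign (p q x y : R) : x <= y ->
  (forall t, x <= t <= y -> p + q * t != 0) ->
  (0 < p + q * x) = (0 < p + q * y).
Proof.
move=> xy nz.
have nx := nz x; rewrite lexx xy in nx; have {}nx := nx isT.
have ny := nz y; rewrite lexx xy in ny; have {}ny := ny isT.
have [q0|q0] := eqVneq q 0; first by rewrite q0 !mul0r.
(* The only zero of the affine function is [- p / q], which must therefore lie outside the
   interval. *)
have zr := nz (- p / q); move: zr.
have -> : p + q * (- p / q) = 0 by field.
rewrite eqxx => zr.
have {zr} : ~~ (x <= - p / q <= y) by apply/negP => /zr.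
case: (ltgtP q 0) q0 => // q0 _.
  rewrite ler_ndivlMr // ler_ndivrMr // => zr.
  by apply/idP/idP; move: zr nx ny; rewrite negb_and -!ltNge !neq_lt; nra.
rewrite ler_pdivlMr // ler_pdivrMr // => zr.
by apply/idP/idP; move: zr nx ny; rewrite negb_and -!ltNge !neq_lt; nra.
Qed.

(** All four tests ask whether [ab] lies below [cd], each at one end of a segment. When the ranges
    of abscissas overlap, the half-open conventions select one test for each end of the overlap, or
    none if it is reduced to a point; the gap between the lines keeps its sign there, so the
    selected tests agree. *)
Lemma disjoint_segments a b c d : a.1 != b.1 -> c.1 != d.1 ->
  segment a b `&` segment c d = set0 ->
  upward a c d (+) upward b c d = downward c a b (+) downward d a b.
Proof.
wlog ab : a b / a.1 < b.1 => [hw neq|_].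
  move: (neq); rewrite neq_lt => /orP[ab|ba]; first exact: hw.
  rewrite segment_sym addbC !(downwardC _ a); apply: hw => //.
  by rewrite eq_sym.
wlog cd : c d / c.1 < d.1 => [hw neq|_].
  move: (neq); rewrite neq_lt => /orP[cd|dc]; first exact: hw.
  rewrite (segment_sym c) (addbC (downward _ _ _)) !(upwardC _ c).
  by apply: hw => //; rewrite eq_sym.
move=> disj.
have neqab : a.1 != b.1 by rewrite lt_eqF.
have neqcd : c.1 != d.1 by rewrite lt_eqF.
have nz x : a.1 <= x <= b.1 -> c.1 <= x <= d.1 -> yat a b x != yat c d x.
  move=> xab xcd; apply/eqP => e.
  have : (segment a b `&` segment c d) (x, yat a b x).
    by split; [exact: yat_on_segment | rewrite e; exact: yat_on_segment].
  by rewrite disj.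
have same x y : x <= y -> a.1 <= x -> c.1 <= x -> y <= b.1 -> y <= d.1 ->
    (yat a b x < yat c d x) = (yat a b y < yat c d y).
  move=> xy ax cx yb yd.
  have aff t : yat c d t - yat a b t =
      (c.2 - a.2 - c.1 * ((d.2 - c.2) / (d.1 - c.1))
               + a.1 * ((b.2 - a.2) / (b.1 - a.1)))
      + ((d.2 - c.2) / (d.1 - c.1) - (b.2 - a.2) / (b.1 - a.1)) * t.
    by rewrite /yat; ring.
  rewrite -!(subr_gt0 (yat a b _)) !aff; apply: affine_same_sign => // t.
  move=> /andP[xt ty]; rewrite -aff subr_eq0 eq_sym.
  by apply: nz; apply/andP; split; lra.
have upE z : upward z c d = [&& c.1 < z.1, z.1 <= d.1 & z.2 < yat c d z.1].
  rewrite upwardE andbA; congr andb; apply/orP/idP => [[]//|]; last by right.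
  by move=> /andP[? ?]; apply/andP; split; lra.
have downE z : downward z a b = [&& a.1 <= z.1, z.1 < b.1 & yat a b z.1 < z.2].
  rewrite downwardE andbA; congr andb; apply/orP/idP => [[]//|]; last by left.
  by move=> /andP[? ?]; apply/andP; split; lra.
rewrite !upE !downE.
(* Every test becomes the sign of the same gap between the two lines, so that [same] can compare
   them. *)
have -> : (a.2 < yat c d a.1) = (yat a b a.1 < yat c d a.1) by rewrite yat_l.
have -> : (b.2 < yat c d b.1) = (yat a b b.1 < yat c d b.1) by rewrite yat_r.
have -> : (yat a b c.1 < c.2) = (yat a b c.1 < yat c d c.1) by rewrite yat_l.
have -> : (yat a b d.1 < d.2) = (yat a b d.1 < yat c d d.1) by rewrite yat_r.
case: (ltP c.1 a.1) => ca; case: (leP a.1 d.1) => ad;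
  case: (ltP c.1 b.1) => cb; case: (leP b.1 d.1) => bd //=; try lra.
- by rewrite (same a.1 b.1) ?addbb //; lra.
- by rewrite addbF (same a.1 d.1) //; lra.
- by rewrite addbF (same c.1 b.1) //; lra.
- by rewrite (same c.1 d.1) ?addbb //; lra.
Qed.

Lemma yat_gap a b x y : a.1 != b.1 ->
  y - yat a b x = ((b.1 - a.1) * (y - b.2) - (b.2 - a.2) * (x - b.1)) / (b.1 - a.1).
Proof. by move=> ab; rewrite /yat; field; rewrite subr_eq0 eq_sym. Qed.

(** The winding is odd iff the path turns back horizontally while its tangent passes through the
    upward vertical. When it turns back, exactly one of [a] and [c] is in the half-open range of the
    other segment, and either test asks whether [bc] lies above [ab]. *)
Lemma consecutive_segments a b c : a.1 != b.1 -> b.1 != c.1 ->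
  odd (absz (wind2 (0, 1) (b - a) (c - b))) = downward c a b (+) upward a b c.
Proof.
move=> ab bc; rewrite downwardE upwardE (yatC b c a.1) //.
have cb : c.1 != b.1 by rewrite eq_sym.
rewrite -(subr_gt0 (yat a b _)) -(subr_lt0 (yat c b _)) !yat_gap //.
(* Up to sign, both gaps have the cross product of the two edges as numerator. *)
have -> : (b.1 - c.1) * (a.2 - b.2) - (b.2 - c.2) * (a.1 - b.1) =
  - ((b.1 - a.1) * (c.2 - b.2) - (b.2 - a.2) * (c.1 - b.1)) by ring.
rewrite /wind2 /orient /cross /= !mulr1 !mulr0 subr0 mul0r mul1r add0r opprB.
set C := _ - _ * (c.1 - b.1).
clearbody C.
have oddC : odd (absz (if sgz C == 1 then sgz C else 0)) = (0 < C) by case: sgzP.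
have oddCN : odd (absz (if sgz C == -1 then sgz C else 0)) = (C < 0) by case: sgzP.
move: (ab) (bc); rewrite !neq_lt => /orP[{}ab|ba] /orP[{}bc|{}cb].
- rewrite (@gtr0_sgz _ (b.1 - a.1)) ?subr_gt0 // (@ltr0_sgz _ (b.1 - c.1)) ?subr_lt0 //.
  have -> : (b.1 < a.1) = false by lra.
  have -> : (c.1 < b.1) = false by lra.
  have -> : (b.1 <= c.1 < a.1) = false by apply/negP; lra.
  have -> : (c.1 < a.1 <= b.1) = false by apply/negP; lra.
  by rewrite /= !andbF.
- rewrite (@gtr0_sgz _ (b.1 - a.1)) ?subr_gt0 // (@gtr0_sgz _ (b.1 - c.1)) ?subr_gt0 //.
  rewrite eqxx andbT oddC.
  rewrite pmulr_lgt0 ?invr_gt0 ?subr_gt0 // pmulr_llt0 ?invr_gt0 ?subr_gt0 //.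
  rewrite oppr_lt0 cb (ltW ab) !andbT.
  have -> : (b.1 <= c.1 < a.1) = false by apply/negP; lra.
  have -> : (b.1 < a.1 <= c.1) = false by apply/negP; lra.
  by rewrite !orbF leNgt; case: (0 < C); case: (c.1 < a.1).
- rewrite (@ltr0_sgz _ (b.1 - a.1)) ?subr_lt0 // (@ltr0_sgz _ (b.1 - c.1)) ?subr_lt0 //.
  rewrite eqxx andbT oddCN.
  rewrite nmulr_lgt0 ?invr_lt0 ?subr_lt0 // nmulr_llt0 ?invr_lt0 ?subr_lt0 //.
  rewrite oppr_gt0 ba (ltW bc) /=.
  have -> : (a.1 <= c.1 < b.1) = false by apply/negP; lra.
  have -> : (c.1 < a.1 <= b.1) = false by apply/negP; lra.
  by rewrite /= leNgt; case: (C < 0); case: (c.1 < a.1).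
- rewrite (@ltr0_sgz _ (b.1 - a.1)) ?subr_lt0 // (@gtr0_sgz _ (b.1 - c.1)) ?subr_gt0 //.
  have -> : (a.1 <= c.1 < b.1) = false by apply/negP; lra.
  have -> : (b.1 <= c.1 < a.1) = false by apply/negP; lra.
  have -> : (c.1 < a.1 <= b.1) = false by apply/negP; lra.
  have -> : (b.1 < a.1 <= c.1) = false by apply/negP; lra.
  by rewrite /= !andbF.
Qed.

End Folds.

(** * The disk and the direction of the rays *)

(** In the chart [psi] the point lies on the unit circle; [g] is the image under [phi] of the radial
    half-line through it, which leaves the round disk at parameter 1. *)
Lemma disk_escape (R : realType) (D : set (R * R)) (z : R * R) :
  closed_disk D -> D z -> closure (~` D) z ->
  exists g : R -> R * R, [/\ continuous g, g 1 = z,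
    forall t, 1 < t -> ~ D (g t) & forall M, exists2 t, 1 <= t & ~~ in_box M (g t)].
Proof.
move=> [phi [psi [cphi cpsi phiK psiK ->]]] Dz cDz.
pose nsq (p : R * R) := p.1 ^+ 2 + p.2 ^+ 2.
set p := psi z.
have cnsq : continuous nsq.
  move=> q; apply: cvgD; rewrite /=.
    by apply: cvgM; exact: cvg_fst.
  by apply: cvgM; exact: cvg_snd.
(* A norm below 1 would give [z] a neighbourhood inside the disk. *)
have p1 : nsq p = 1.
  apply/eqP; rewrite eq_le; apply/andP; split.
    by case: Dz => q q1 qz; rewrite /p -qz phiK.
  rewrite leNgt; apply/negP => lt1.
  have : \forall y \near z, nsq (psi y) < 1.
    exact: (cpsi z _ (cnsq (psi z) _ (lt_nbhsl lt1))).
  move=> /cDz [y [nDy /= ylt]]; apply: nDy; exists (psi y); last exact: psiK.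
  exact: ltW.
have nsqZ t : nsq (t *: p) = t ^+ 2.
  by rewrite -[RHS]mulr1 -p1 /nsq /= /GRing.scale /=; ring.
exists (fun t => phi (t *: p)); split.
- move=> t; apply: (@cvg_comp _ _ _ (fun t : R => t *: p) phi); last exact: cphi.
  by apply: cvgZr_tmp; exact: cvg_id.
- by rewrite scale1r /p psiK.
- move=> t t1 [q q1 /(can_inj phiK) qt].
  by have : nsq q <= 1 by []; rewrite qt nsqZ; nra.
- move=> M.
  (* Since [psi] maps the box to a bounded set, the radial half-line leaves that set;
     [(K + 2) / |p|] makes the norm exceed the bound [K + 1]. *)
  have /compact_bounded[K [_ hK]] : compact (psi @` (`[-M, M] `*` `[-M, M])).
    apply: continuous_compact; first exact: continuous_subspaceT.
    by apply: compact_setX; exact: segment_compact.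
  have p0 : 0 < `|p|.
    rewrite normr_gt0; apply/eqP => p0.
    by move: p1; rewrite p0 /nsq /= expr0n addr0 => /eqP; rewrite eq_sym oner_eq0.
  exists (Num.max 1 ((K + 2) / `|p|)); first by rewrite le_max lexx.
  set t := Num.max _ _; apply/negP => bx.
  have : `|t *: p| <= K + 1.
    apply: (hK (K + 1)); first by rewrite ltrDl.
    exists (phi (t *: p)); last exact: phiK.
    by move: bx; rewrite /in_box !ler_norml => /andP[? ?]; split; rewrite /= in_itv.
  rewrite normrZ leNgt; apply/negP; rewrite negbK.
  have t0 : (K + 2) / `|p| <= t by rewrite le_max lexx orbT.
  rewrite (lt_le_trans _ (ler_wpM2r _ (ler_norm t))) //.
  by move: t0; rewrite ler_pdivrMr //; lra.
Qed.

(** * Coordinates adapted to the direction of the rays *)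

Section Coordinates.
Context {R : realType}.
Implicit Types (a b d z u v w l : R * R).

(* Coordinates in which l is vertical, up to the scaling by the norm of l. *)
Definition coord l v : R * R := (cross v l, dot v l).

Lemma sqnorm_gt0 l : l <> 0 -> 0 < dot l l.
Proof.
case: l => l1 l2 h; rewrite /dot /= -!expr2.
rewrite lt_def addr_ge0 ?sqr_ge0 // andbT paddr_eq0 ?sqr_ge0 // !sqrf_eq0.
by apply/negP => /andP[/eqP h1 /eqP h2]; apply: h; rewrite h1 h2.
Qed.

Lemma coordB l u v : coord l (u - v) = coord l u - coord l v.
Proof. by rewrite /coord /cross /dot; congr pair => /=; ring. Qed.

Lemma coord_affine l a b (t : R) :
  coord l (a + t *: (b - a)) = coord l a + t *: (coord l b - coord l a).
Proof. by rewrite !pair_affine /coord /cross /dot; congr pair => /=; ring. Qed.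

Lemma coord_inv l v : l <> 0 ->
  v = ((cross v l * l.2 + dot v l * l.1) / dot l l,
       (dot v l * l.2 - cross v l * l.1) / dot l l).
Proof.
move=> /sqnorm_gt0; case: v l => [v1 v2] [l1 l2]; rewrite /cross /dot /= => l0.
by congr pair; field; rewrite gt_eqF.
Qed.

Lemma coord_inj l : l <> 0 -> injective (coord l).
Proof.
move=> l0 u v [h1 h2].
by rewrite (coord_inv l u l0) (coord_inv l v l0) h1 h2.
Qed.

Lemma parallelE l d : l <> 0 -> cross d l = 0 -> d = (dot d l / dot l l) *: l.
Proof.
move=> l0 h; rewrite {1}(coord_inv l d l0) h !mul0r subr0 add0r.
by rewrite (surjective_pairing l) /GRing.scale /= /GRing.scale /=; congr pair; rewrite mulrAC.
Qed.

(** What the escape argument requires of a change of coordinates: it keeps curves continuous,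
    creates no new incidence with segments, and sends curves escaping to infinity to such curves.
    Stability under both flips allows [upward] and [downward] to be treated as [under]. *)
Definition planar_map (K : R * R -> R * R) :=
  [/\ continuous K,
      forall a b z, segment (K a) (K b) (K z) -> segment a b z
    & forall M, exists M', forall z, in_box M (K z) -> in_box M' z].

Lemma continuous_pair (f g : R * R -> R) :
  continuous f -> continuous g -> continuous (fun v => (f v, g v)).
Proof. by move=> cf cg z; exact: (cvg_pair (cf z) (cg z)). Qed.

Lemma planar_map_coord l : l <> 0 -> planar_map (coord l).
Proof.
move=> l0; split.
- apply: continuous_pair => v.
    apply: cvgB; apply: cvgM; try exact: cvg_cst; [exact: cvg_fst|exact: cvg_snd].
  apply: cvgD; apply: cvgM; try exact: cvg_cst; [exact: cvg_fst|exact: cvg_snd].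
- move=> a b z [t t01 e]; exists t => //.
  by apply: (coord_inj l l0); rewrite coord_affine.
- move=> M; exists ((M * `|l.2| + M * `|l.1|) / dot l l) => z /andP[/= h1 h2].
  have ll := sqnorm_gt0 l l0.
  rewrite (coord_inv l z l0) /in_box /=.
  have li : 0 <= (dot l l)^-1 by rewrite invr_ge0 ltW.
  rewrite !normrM !(ger0_norm li).
  rewrite !ler_pM2r ?invr_gt0 //; apply/andP; split.
    apply: le_trans (ler_normD _ _) _; rewrite !normrM.
    by apply: lerD; apply: ler_wpM2r.
  apply: le_trans (ler_normB _ _) _; rewrite !normrM.
  by apply: lerD; apply: ler_wpM2r.
Qed.

Lemma planar_map_flipx K : planar_map K -> planar_map (flipx \o K).
Proof.
move=> [cK sK bK]; split.
- move=> z; apply: cvg_comp; first exact: cK.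
  apply: (@continuous_pair (fun v => - v.1) (fun v => v.2)); last by move=> v; exact: cvg_snd.
  by move=> v; apply: cvgN; exact: cvg_fst.
- move=> a b z [t t01 e]; apply: sK; exists t => //.
  move: e; rewrite !pair_affine [K z]surjective_pairing => -[/= e1 ->].
  by congr pair; apply: oppr_inj; rewrite -e1; ring.
- move=> M; have [M' h] := bK M; exists M' => z hz; apply: h.
  by move: hz; rewrite /in_box /= normrN.
Qed.

Lemma planar_map_flipy K : planar_map K -> planar_map (flipy \o K).
Proof.
move=> [cK sK bK]; split.
- move=> z; apply: cvg_comp; first exact: cK.
  apply: (@continuous_pair (fun v => v.1) (fun v => - v.2)); first by move=> v; exact: cvg_fst.
  by move=> v; apply: cvgN; exact: cvg_snd.
- move=> a b z [t t01 e]; apply: sK; exists t => //.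
  move: e; rewrite !pair_affine [K z]surjective_pairing => -[/= -> e1].
  by congr pair; apply: oppr_inj; rewrite -e1; ring.
- move=> M; have [M' h] := bK M; exists M' => z hz; apply: h.
  by move: hz; rewrite /in_box /= normrN.
Qed.

(** The change of coordinates multiplies cross products by the positive number [dot l l] and makes
    [l] point vertically upwards. *)
Lemma wind2_coord l u v : l <> 0 ->
  wind2 l u v = wind2 (0, 1) (coord l u) (coord l v).
Proof.
move=> /sqnorm_gt0 l0; rewrite /wind2 /orient.
have -> : cross (coord l u) (coord l v) = dot l l * cross u v.
  by rewrite /coord /cross /dot /=; ring.
have -> : cross (coord l u) (0, 1) = cross u l by rewrite {1}/cross /=; ring.
have -> : cross (0, 1) (coord l v) = cross l v.
  by rewrite {1}/cross /= /cross; ring.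
by rewrite sgzM (gtr0_sgz l0) mul1r.
Qed.

Lemma near_ray b v (P : set (R * R)) :
  (\forall y \near b, P y) -> \forall s \near 0^'+, P (b + s *: v).
Proof.
move=> h; apply: cvg_within.
have : (fun s : R => b + s *: v) @ 0 --> b + (0 : R) *: v.
  apply: cvgD; first exact: cvg_cst.
  by apply: cvgZr_tmp; exact: cvg_id.
by rewrite scale0r addr0; apply.
Qed.

Lemma crossDZ w u v (s : R) : cross w (u + s *: v) = cross w u + s * cross w v.
Proof.
by case: w u v => [? ?] [? ?] [? ?]; rewrite /cross /= /GRing.scale /=; ring.
Qed.

End Coordinates.

(** * The disk and the edges near a boundary vertex *)

Section Boundary.
Context {R : realType} {n : nat} (G : drawing R n).
Local Notation bd i := (pos (inl i : 'I_n + ivertex G)).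

Lemma boundary_line : straight_clockwise_boundary G ->
  exists2 w : R * R, w <> 0 &
    (forall i, \forall y \near bd i, disk G y <-> cross w (y - bd i) <= 0)
    /\ (forall i j, exists c : R, bd j - bd i = c *: w).
Proof.
move=> [p [q [t [pq ht _ hD]]]]; exists (q - p).
  by move=> /eqP; rewrite subr_eq0 => /eqP e; apply: pq.
split=> [i|i j].
  by apply: hD; have [t01 ->] := ht i; exists (t i).
exists (t j - t i); have [_ ->] := ht i; have [_ ->] := ht j.
by rewrite scalerBl opprD addrACA subrr add0r.
Qed.

Hypothesis drawn : drawn_in_disk G.

Lemma boundary_in_disk i : disk G (bd i).
Proof.
have [_ /boundary_line[w _ [h _]] _ _] := drawn.
by have /nbhs_singleton[_] := h i; apply; rewrite subrr /cross /= !mulr0 subrr.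
Qed.

(** A quarter turn of [w]. It points out of the disk, which near a boundary vertex is the half-plane
    of nonpositive cross product with [w]. *)
Definition normal (w : R * R) : R * R := (- w.2, w.1).

Lemma cross_normal (w : R * R) : w <> 0 -> 0 < cross w (normal w).
Proof. by move=> /sqnorm_gt0; rewrite /cross /dot /= mulrN opprK. Qed.

Lemma boundary_in_closure i : closure (~` disk G) (bd i).
Proof.
have [_ /boundary_line[w w0 [h _]] _ _] := drawn.
move=> B hB.
have hn : \forall s \near (0 : R)^'+, B (bd i + s *: normal w) /\
    (disk G (bd i + s *: normal w) <-> cross w (bd i + s *: normal w - bd i) <= 0).
  by apply: (near_ray _ _ (fun y => B y /\ (disk G y <-> cross w (y - bd i) <= 0)));
    apply: filterI => //; exact: h.
near (0 : R)^'+ => s.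
have [Bs Ds] : B (bd i + s *: normal w) /\
    (disk G (bd i + s *: normal w) <-> cross w (bd i + s *: normal w - bd i) <= 0).
  by near: s.
exists (bd i + s *: normal w); split=> // /Ds.
rewrite addrAC subrr crossDZ {1}/cross /= !mulr0 subrr add0r leNgt pmulr_rgt0.
  by rewrite cross_normal.
by near: s; exact: nbhs_right_gt.
Unshelve. all: by end_near.
Qed.

Variable l : R * R.
Hypothesis gauge : gauge_ray_direction G l.

(** The ray starts inside the disk, hence in the half-plane, so the cross product is nonpositive. If
    it vanished, the ray would run along the boundary line, and a small step along [normal w] would
    leave the half-plane from an interior point. *)
Lemma ray_transversal (w : R * R) i : w <> 0 ->
  (\forall y \near bd i, disk G y <-> cross w (y - bd i) <= 0) -> cross w l < 0.
Proof.
move=> w0 h; have [_ inside _ _] := gauge.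
near (0 : R)^'+ => s.
have s0 : 0 < s by near: s; exact: nbhs_right_gt.
have intD : interior (disk G) (bd i + s *: l) by near: s; exact: inside.
have h' : \forall y \near bd i + s *: l, disk G y <-> cross w (y - bd i) <= 0.
  near: s; apply: (near_ray _ _ (fun z => \forall y \near z, _)).
  exact: (near_join h).
have le0 : \forall y \near bd i + s *: l, cross w (y - bd i) <= 0.
  by apply: filterS2 intD h' => y Dy [+ _]; apply.
have := nbhs_singleton le0.
rewrite addrAC subrr crossDZ {1}/cross /= !mulr0 subrr add0r pmulr_rle0 //.
rewrite le_eqVlt => /orP[/eqP wl|//].
near (0 : R)^'+ => r.
have r0 : 0 < r by near: r; exact: nbhs_right_gt.
have : cross w (bd i + s *: l + r *: normal w - bd i) <= 0.
  near: r; apply: (near_ray _ _ (fun y => cross w (y - bd i) <= 0)).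
  exact: le0.
rewrite addrAC (addrAC (bd i)) subrr !crossDZ {1}/cross /= !mulr0 subrr add0r wl.
by rewrite mulr0 add0r pmulr_rle0 // leNgt cross_normal.
Unshelve. all: by end_near.
Qed.

(** The gauge condition on parallelism covers internal edges only. Here a second boundary vertex
    would put [l] along the boundary line, an internal vertex in direction [l] would lie on the ray,
    and one in direction [- l] would force the segment out of the disk. *)
Lemma boundary_edge_nonparallel i (x : 'I_n + ivertex G) : injective (@pos R n G) ->
  inl i <> x -> segment (bd i) (pos x) `<=` disk G -> cross (pos x - bd i) l != 0.
Proof.
move=> pinj ix sub; apply/eqP => c0.
have [l0 _ _ noray] := gauge.
have [_ /boundary_line[w w0 [h hw]] _ _] := drawn.
have wl := ray_transversal w i w0 (h i).
have d0 : pos x - bd i <> 0.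
  by move=> /eqP; rewrite subr_eq0 => /eqP /pinj e; apply: ix.
have := parallelE l (pos x - bd i) l0 c0; set c := _ / _ => dl.
have cn0 : c != 0 by apply/eqP => c00; apply: d0; rewrite dl c00 scale0r.
case: x ix sub c0 d0 @c dl cn0 => [j|v] ix sub c0 d0 c dl cn0.
  have [c' e] := hw i j; apply: d0; rewrite e.
  move: c0; rewrite e /cross /= => /eqP.
  have -> : c' *: w.1 * l.2 - c' *: w.2 * l.1 = c' * cross w l.
    by rewrite /cross /GRing.scale /=; ring.
  by rewrite mulf_eq0 (lt_eqF wl) orbF => /eqP ->; rewrite scale0r.
case: (ltgtP c 0) cn0 => // cs _; last first.
  by apply: (noray i v); exists c => //; rewrite -dl addrC subrK.
near (0 : R)^'+ => s.
have s0 : 0 < s by near: s; exact: nbhs_right_gt.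
have s1 : s < 1 by near: s; exact: nbhs_right_lt.
have : disk G (bd i + s *: (pos (inr v) - bd i)) by apply: sub; exists s => //=; lra.
have -> : disk G (bd i + s *: (pos (inr v) - bd i))
   <-> cross w (bd i + s *: (pos (inr v) - bd i) - bd i) <= 0.
  by near: s; apply: (near_ray _ _ (fun y => disk G y <-> cross w (y - bd i) <= 0)); exact: h.
rewrite addrAC subrr dl !crossDZ {1}/cross /= !mulr0 subrr add0r.
rewrite -[c *: l]add0r crossDZ {1}/cross /= !mulr0 subrr add0r.
by rewrite pmulr_rle0 // leNgt nmulr_rgt0 ?wl.
Unshelve. all: by end_near.
Qed.

End Boundary.

(** * Paths in plabic graphs *)

Section Paths.
Context {R : realType} {k n : nat} (N : plabic_graph R k n).
Implicit Types (e f g h : edge N) (P Q S B : seq (edge N)) (i j : 'I_n).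

Local Notation follows := (@follows R n N).

Lemma boundary_sink_unique e f j : tgt e = inl j -> tgt f = inl j -> e = f.
Proof.
move=> te tf; have := boundary_degree N j; rewrite /degree => d1.
have : (in_degree (G := N) (inl j) <= 1)%N by rewrite -d1 leq_addr.
by move/card_le1_eqP; apply; rewrite inE ?te ?tf.
Qed.

Lemma boundary_not_inner e f j : tgt e = inl j -> src f <> inl j.
Proof.
move=> te sf; have := boundary_degree N j; rewrite /degree /in_degree /out_degree.
have : (0 < #|[set x : edge N | tgt x == inl j]%SET|)%N.
  by apply/card_gt0P; exists e; rewrite inE te.
have : (0 < #|[set x : edge N | src x == inl j]%SET|)%N.
  by apply/card_gt0P; exists f; rewrite inE sf.
by case: #|_| => // a; case: #|_| => // b; rewrite addSn addnS.
Qed.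

Lemma follows_internal e f j : follows e f -> tgt e <> inl j /\ src f <> inl j.
Proof.
move=> /eqP ef; split=> [te|sf].
  by apply: (boundary_not_inner e f j te); rewrite -ef.
by apply: (boundary_not_inner e f j _ sf); rewrite ef.
Qed.

Definition internal e := forall j, src e <> inl j /\ tgt e <> inl j.

(** Both ends of an inner edge are shared with a neighbouring edge of the path, which is impossible
    at a boundary vertex of degree one. *)
Lemma inner_edges_internal e S h : path follows e (rcons S h) ->
  {in S, forall g, internal g}.
Proof.
elim: S e => [|g S IH] e //= /andP[eg gS] x.
rewrite inE => /orP[/eqP ->|]; last exact: IH gS x.
move=> j; split; first by have [] := follows_internal _ _ j eg.
by case: S gS {IH} => [|g' S] /= /andP[gg' _]; have [] := follows_internal _ _ j gg'.
Qed.

Lemma internalP e : internal e -> exists u v, src e = inr u /\ tgt e = inr v.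
Proof.
move=> ie; case se: (src e) => [i|u]; first by have [] := ie i.
by case te: (tgt e) => [i|v]; [have [] := ie i | exists u, v].
Qed.

Lemma no_internal_sourceT : no_internal_source N.
Proof.
move=> v; have := internal_color v; have := internal_degree v.
by rewrite /degree; case: white => + e; rewrite e //; case: in_degree.
Qed.

Lemma no_internal_sinkT : no_internal_sink N.
Proof.
move=> v; have := internal_color v; have := internal_degree v.
by rewrite /degree; case: white => + e; rewrite e //; case: out_degree.
Qed.

(** * Paths in acyclic orientations *)

Section Acyclic.
Hypothesis acyc : acyclic N.

Lemma acyclic_uniq e P : path follows e P -> uniq (e :: P).
Proof.
elim: P e => [|f P IH] e //= /andP[ef fP].
have /= -> := IH _ fP; rewrite andbT; apply/negP => eP.
have {fP ef} : path follows e (f :: P) by rewrite /= ef.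
case/splitPr: eP => P1 P2; rewrite cat_path => /andP[eP1 /= /andP[/eqP l1 _]].
exact: (acyc _ _ eP1).
Qed.

Lemma path_size e P : path follows e P -> (size P < #|edge N|)%N.
Proof. by move/acyclic_uniq/card_uniqP => /= <-; exact: max_card. Qed.

Lemma finite_paths e j : finite_set (paths e j).
Proof.
(* All sequences of at most [#|edge N|] edges; [path_size] bounds the tail [P] strictly, hence
   [f :: P] with equality allowed. *)
pose s := flatten [seq [seq val t | t <- enum {: m.-tuple (edge N)}]
                  | m <- iota 0 #|edge N|.+1].
apply: (@sub_finite_set _ _ [set` s]); last exact: finite_seq.
case=> [|f P] [] //= _ fP _; apply/flattenP.
exists [seq val t | t <- enum {: (size P).+1.-tuple (edge N)}].
  apply/mapP; exists (size P).+1 => //.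
  by rewrite mem_iota ltnS; exact: path_size fP.
by apply/mapP; exists (in_tuple (f :: P)); rewrite ?mem_enum.
Qed.

Lemma path_to_sink e : exists P j, path follows e P /\ tgt (last e P) = inl j.
Proof.
(* The path is prolonged one edge at a time until it reaches the boundary; a tail of [#|edge N|]
   edges would be too long. *)
suff /(_ #|edge N|) [P [eP [[j ?]|sP]]] : forall m, exists P, path follows e P /\
    ((exists j, tgt (last e P) = inl j) \/ size P = m).
- by exists P, j.
- by have := path_size _ _ eP; rewrite sP ltnn.
elim=> [|m [P [eP [[j tP]|sP]]]]; first by exists [::]; split=> //; right.
  by exists P; split=> //; left; exists j.
case tl: (tgt (last e P)) => [j|v]; first by exists P; split=> //; left; exists j.
have /card_gt0P[f] := no_internal_sinkT v; rewrite inE => /eqP fv.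
exists (rcons P f); rewrite size_rcons sP; split; last by right.
by rewrite rcons_path eP /follows /= tl fv.
Qed.

Lemma path_from_source e : exists f P i,
  [/\ path follows f P, last f P = e & src f = inl i].
Proof.
suff /(_ #|edge N|) [f [P [fP lP [[j ?]|sP]]]] : forall m, exists f P,
    [/\ path follows f P, last f P = e &
        (exists j, src f = inl j) \/ size P = m].
- by exists f, P, j.
- by have := path_size _ _ fP; rewrite sP ltnn.
elim=> [|m [f [P [fP lP [[j tP]|sP]]]]]; first by exists e, [::]; split=> //; right.
  by exists f, P; split=> //; left; exists j.
case sf: (src f) => [j|v]; first by exists f, P; split=> //; left; exists j.
have /card_gt0P[g] := no_internal_sourceT v; rewrite inE => /eqP gv.
exists g, (f :: P); split=> //=; last by right; rewrite sP.
by rewrite fP andbT /follows /= gv sf.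
Qed.

(** By planarity distinct edges meet only at a common vertex, and a vertex common to two
    non-consecutive edges of a path closes a directed cycle. *)
Lemma acyclic_edges_disjoint e f P g : path follows e (f :: P) -> g \in P ->
  eseg e `&` eseg g = set0.
Proof.
move=> eP gP; rewrite -subset0 => p [pe pg].
have [_ _ _ meet] := planar_pdrawing N.
have [P1 [P2 PE]] : exists P1 P2, P = P1 ++ g :: P2.
  by case/splitPr: gP => P1 P2; exists P1, P2.
have {eP} : path follows e ((f :: P1) ++ g :: P2) by rewrite /= -PE.
rewrite cat_path => /andP[eP1 /= /andP[/eqP lg _]].
have fP1 : path follows f P1 by case/andP: eP1.
have ef : tgt e = src f by case/andP: eP1 => /eqP.
have eP1g : path follows e (rcons (f :: P1) g) by rewrite rcons_path eP1 /follows /= lg.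
have fP1g : path follows f (rcons P1 g) by move: eP1g; rewrite /= => /andP[].
have neq : e <> g.
  by move=> eg; apply: (acyc _ _ eP1); rewrite /= lg eg.
have [x [_ [-> [h|h]|-> [h|h]]]] := meet _ _ _ neq pe pg.
- by apply: (acyc _ _ eP1); rewrite /= lg.
- by apply: (acyc _ _ eP1g); rewrite last_rcons.
- by apply: (acyc _ _ fP1); rewrite lg -ef.
- by apply: (acyc _ _ fP1g); rewrite last_rcons -ef.
Qed.

End Acyclic.
End Paths.

(** * Parity of the winding and intersection numbers *)

Lemma odd_abszD (x y : int) : odd (absz (x + y)) = odd (absz x) (+) odd (absz y).
Proof. by lia. Qed.

Lemma odd_sum (I : Type) (r : seq I) (P : pred I) (F : I -> nat) :
  odd (\sum_(i <- r | P i) F i) = \big[addb/false]_(i <- r | P i) odd (F i).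
Proof. by apply: big_morph => //; exact: oddD. Qed.

Lemma odd_card_addb (T : finType) (A : {set T}) (p : pred T) :
  odd #|[set x in A | p x]%SET| = \big[addb/false]_(x in A) p x.
Proof.
rewrite -sum1_card (eq_bigl (fun x => (x \in A) && p x)); last by move=> x; rewrite inE.
rewrite big_mkcondr odd_sum; apply: eq_bigr => x _.
by case: (p x).
Qed.

Section Parity.
Context {R : realType} {k n : nat} (N : plabic_graph R k n) (l : R * R).
Hypothesis gauge : gauge_ray_direction N l.
Implicit Types (e f g h : edge N) (P Q S B : seq (edge N)) (i j : 'I_n).

Local Notation follows := (@follows R n N).
Local Notation bd i := (pos (inl i : 'I_n + ivertex N)).

Lemma edge_nonvertical e :
  (coord l (pos (src e))).1 != (coord l (pos (tgt e))).1.
Proof.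
have [pinj noloop _ _] := planar_pdrawing N.
have [_ _ _ inD] := pdrawn_in_disk N.
have [_ _ notpar _] := gauge.
suff : cross (evec e) l != 0.
  apply: contra_neq => /= h.
  by rewrite /cross /= mulrBl mulrBl opprB addrACA; move: h; rewrite /cross; lra.
have sub := inD e; rewrite /eseg in sub; rewrite /evec.
have nl := noloop e.
case se: (src e) sub nl => [i|u] sub nl.
  by apply: (boundary_edge_nonparallel N (pdrawn_in_disk N) l gauge).
case te: (tgt e) sub nl => [j|v] sub nl; last first.
  have := notpar e u v se te; rewrite /orient => h; apply: contra_notN h.
  by rewrite /evec se te => /eqP ->; rewrite sgz0.
have : cross (pos (inr u) - bd j) l != 0.
  apply: (boundary_edge_nonparallel N (pdrawn_in_disk N) l gauge) => //.
  by rewrite segment_sym.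
by apply: contra_neq; rewrite /cross /=; lra.
Qed.

Definition sides (r : R * R -> R * R -> R * R -> bool) (z : R * R) S : bool :=
  \big[addb/false]_(g <- S) r (coord l z) (coord l (pos (src g))) (coord l (pos (tgt g))).

Lemma crossings_sides (K : R * R -> R * R) z e S : path follows e S ->
  crossings (K z) (K (pos (tgt e))) [seq K (pos (tgt g)) | g <- S]
  = \big[addb/false]_(g <- S) under (K z) (K (pos (src g))) (K (pos (tgt g))).
Proof.
elim: S e => [|f S IH] e /=; first by rewrite big_nil.
by move=> /andP[/eqP ef fS]; rewrite big_cons IH // ef.
Qed.

Lemma polyline_eseg (K : R * R -> R * R) z e S : planar_map K ->
  path follows e S ->
  polyline (K (pos (tgt e))) [seq K (pos (tgt g)) | g <- S] (K z) ->
  exists2 g, g \in S & eseg g z.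
Proof.
move=> [_ sK _]; elim: S e => [|f S IH] e //= /andP[/eqP ef fS] [h|/(IH _ fS)[g gS h]].
  by exists f; rewrite ?mem_head //; apply: sK; rewrite -ef.
by exists g; rewrite // inE gS orbT.
Qed.

Lemma nonvertical_path (K : R * R -> R * R) e S :
  (forall g, nonvertical (K (pos (src g))) (K (pos (tgt g)))) ->
  path follows e S ->
  path nonvertical (K (pos (tgt e))) [seq K (pos (tgt g)) | g <- S].
Proof.
move=> nv; elim: S e => [|f S IH] e //= /andP[/eqP ef fS].
by rewrite IH // andbT ef; exact: nv.
Qed.

(** The vertex [b_i] is joined to infinity outside the disk, whereas both polygonal lines stay in
    the disk and avoid [b_i], so [crossings_eq_at_end] applies. *)
Lemma under_eq_sides (K : R * R -> R * R) i e S S' : planar_map K ->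
  (forall g, nonvertical (K (pos (src g))) (K (pos (tgt g)))) ->
  path follows e S -> path follows e S' ->
  tgt (last e S) = tgt (last e S') ->
  {in S, forall g, internal N g} -> {in S', forall g, internal N g} ->
  \big[addb/false]_(g <- S) under (K (bd i)) (K (pos (src g))) (K (pos (tgt g)))
  = \big[addb/false]_(g <- S') under (K (bd i)) (K (pos (src g))) (K (pos (tgt g))).
Proof.
move=> pK nv eS eS' ll iS iS'.
have dD := pdrawn_in_disk N; have [clD _ _ inD] := dD.
have [_ _ vert _] := planar_pdrawing N.
have [g [cg g1 gout gesc]] :=
  disk_escape _ _ _ clD (boundary_in_disk N dD i) (boundary_in_closure N dD i).
(* For [t > 1] the curve is outside the disk; at [t = 1] it is at [b_i], which an edge contains only
   as one of its ends. *)
have off (S0 : seq (edge N)) t : path follows e S0 -> {in S0, forall g, internal N g} ->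
    1 <= t -> ~ polyline (K (pos (tgt e))) [seq K (pos (tgt g)) | g <- S0] (K (g t)).
  move=> eS0 iS0 t1 /(polyline_eseg _ _ _ _ pK eS0)[f fS0 fg].
  move: t1; rewrite le_eqVlt => /orP[/eqP t1|/gout]; last by apply; exact: inD fg.
  move: fg; rewrite -t1 g1 => /vert.
  by have [sf tf] := iS0 f fS0 i; case=> ?; [apply: sf | apply: tf].
rewrite -!(crossings_sides K _ e) // -g1.
have [cK _ bK] := pK.
apply: (crossings_eq_at_end _ _ _ (K \o g)).
- exact: nonvertical_path.
- exact: nonvertical_path.
- by rewrite !(last_map (fun g => K (pos (tgt g)))) /= ll.
- by move=> t; apply: continuous_comp; [exact: cg | exact: cK].
- by move=> t; exact: off.
- by move=> t; exact: off.
- move=> M; have [M' hM'] := bK M; have [t t1 tM] := gesc M'.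
  by exists t => //; apply: contra tM => /hM'.
Qed.

Lemma planar_map_l : planar_map (coord l).
Proof. by apply: planar_map_coord; have [] := gauge. Qed.

Lemma sides_eq r i e S S' h :
  r = under \/ r = upward \/ r = downward ->
  path follows e (rcons S h) -> path follows e (rcons S' h) ->
  sides r (bd i) S = sides r (bd i) S'.
Proof.
move=> hr eS eS'; have iS := inner_edges_internal N _ _ _ eS.
have iS' := inner_edges_internal N _ _ _ eS'.
move: eS eS'; rewrite !rcons_path => /andP[eS /eqP ll] /andP[eS' /eqP ll'].
have {ll'} ll : tgt (last e S) = tgt (last e S') by rewrite ll.
case: hr => [->|[->|->]].
- exact: (under_eq_sides _ i e S S' planar_map_l edge_nonvertical).
- apply: (under_eq_sides _ i e S S' (planar_map_flipx _ planar_map_l)) => // g.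
  by rewrite /nonvertical /= eqr_opp edge_nonvertical.
- apply: (under_eq_sides _ i e S S' (planar_map_flipy _ planar_map_l)) => // g.
  exact: edge_nonvertical.
Qed.

(** The half-open range in [under] differs from the full range of the edge only when the ray passes
    through an end of the edge, which the gauge conditions exclude. *)
Lemma meets_ray i g : internal N g ->
  `[< eseg g `&` open_ray N l i !=set0 >]
  = under (coord l (bd i)) (coord l (pos (src g))) (coord l (pos (tgt g))).
Proof.
move=> /internalP[u [v [su tv]]]; have [l0 _ _ noray] := gauge.
have ll := sqnorm_gt0 l l0.
have nv := edge_nonvertical g; move: nv.
rewrite /eseg su tv.
wlog uv : u v {su tv} / (coord l (pos (inr u : 'I_n + ivertex N))).1 <
                (coord l (pos (inr v : 'I_n + ivertex N))).1 => [hw nv|_].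
  move: (nv); rewrite neq_lt => /orP[uv|vu]; first exact: hw.
  by rewrite segment_sym underC; apply: hw => //; rewrite eq_sym.
set b := bd i; set a := pos (inr u) in uv *; set c := pos (inr v) in uv *.
apply/asboolP/idP => [[p [pg [t t0 pE]]]|].
  have pb1 : (coord l p).1 = (coord l b).1.
    by rewrite -pE /coord /cross /= /GRing.scale /=; ring.
  have pb2 : (coord l p).2 = (coord l b).2 + t * dot l l.
    by rewrite -pE /coord /dot /= /GRing.scale /=; ring.
  have : segment (coord l a) (coord l c) (coord l p).
    by case: pg => s s01 <-; exists s; rewrite ?coord_affine.
  move=> /(segment_yat _ _ _ uv)[/andP[h1 h2] h3].
  rewrite /under -pb1 h1 -h3 pb2 ltrDl mulr_gt0 // andbT /=.
  suff -> : (coord l p).1 < (coord l c).1 by [].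
  rewrite lt_neqAle h2 andbT; apply/eqP => h4.
  have pc : p = c.
    apply: (coord_inj l l0); rewrite [LHS]surjective_pairing h3 h4 yat_r //.
    by rewrite lt_eqF.
  by apply: (noray i v); exists t => //; rewrite pE pc.
rewrite /under => /andP[/orP[/andP[h1 h2]|/andP[h1 h2]] h3]; last first.
  by have := lt_trans (le_lt_trans h1 h2) uv; rewrite ltxx.
have [s s01 sE] : segment (coord l a) (coord l c)
    ((coord l b).1, yat (coord l a) (coord l c) (coord l b).1).
  by apply: yat_on_segment => //; rewrite h1 ltW.
rewrite -coord_affine in sE.
set p := a + s *: (c - a) in sE.
exists p; split; first by exists s.
have par : cross (p - b) l = 0.
  have -> : cross (p - b) l = (coord l p).1 - (coord l b).1.
    by rewrite /coord /cross /=; ring.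
  by rewrite sE subrr.
exists (dot (p - b) l / dot l l); last by rewrite -parallelE // addrC subrK.
rewrite /= divr_gt0 //.
have -> : dot (p - b) l = (coord l p).2 - (coord l b).2.
  by rewrite /coord /dot /=; ring.
by rewrite sE subr_gt0.
Qed.

(** Double counting: the sum over edges of the rays met is rearranged as a sum over boundary
    sources. *)
Lemma odd_int_path S : {in S, forall g, internal N g} ->
  odd (int_path l S) = \big[addb/false]_(i in sources N) sides under (bd i) S.
Proof.
move=> iS; rewrite /int_path odd_sum.
rewrite exchange_big big_seq [RHS]big_seq; apply: eq_bigr => g /iS ig.
by rewrite /int_edge odd_card_addb; apply: eq_bigr => i _; exact: meets_ray.
Qed.

Lemma int_path_parity e S S' h :
  path follows e (rcons S h) -> path follows e (rcons S' h) ->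
  odd (int_path l (e :: rcons S h)) = odd (int_path l (e :: rcons S' h)).
Proof.
move=> eS eS'; rewrite /int_path -!cats1 !big_cons !big_cat /= !oddD.
congr (_ (+) (_ (+) _)).
rewrite -!/(int_path l _) !odd_int_path; first by apply: eq_bigr => i _;
  apply: (sides_eq _ _ e _ _ h) => //; left.
  exact: inner_edges_internal eS'.
exact: inner_edges_internal eS.
Qed.

Lemma wind_cons e f P :
  wind l (e :: f :: P) = wind2 l (evec e) (evec f) + wind l (f :: P).
Proof. by rewrite /wind /sum_consecutive /= big_cons. Qed.

Lemma wind1 e : wind l [:: e] = 0.
Proof. by rewrite /wind /sum_consecutive /= big_nil. Qed.

(** The last edge of the first piece is repeated so that the corner at the junction is counted
    once. *)
Lemma wind_cat e B P : wind l (e :: B ++ P) = wind l (e :: B) + wind l (last e B :: P).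
Proof.
elim: B e => [|f B IH] e /=; first by rewrite wind1 add0r.
by rewrite !wind_cons IH addrA.
Qed.

Lemma odd_wind2 e f : follows e f ->
  odd (absz (wind2 l (evec e) (evec f)))
  = sides downward (pos (tgt f)) [:: e] (+) sides upward (pos (src e)) [:: f].
Proof.
move=> /eqP ef; have l0 : l <> 0 by have [] := gauge.
rewrite wind2_coord // /evec !coordB /sides !big_seq1 -ef.
apply: consecutive_segments; first exact: edge_nonvertical.
by rewrite ef; exact: edge_nonvertical.
Qed.

Lemma coord_disjoint (a b c d : R * R) : segment a b `&` segment c d = set0 ->
  segment (coord l a) (coord l b) `&` segment (coord l c) (coord l d) = set0.
Proof.
have [_ sK _] := planar_map_l.
move=> disj; rewrite -subset0 => q [[t t01 <-]]; rewrite -coord_affine => h.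
have : (segment a b `&` segment c d) (a + t *: (b - a)).
  by split; [exists t | exact: sK].
by rewrite disj.
Qed.

Lemma sides_cons r z e P : sides r z (e :: P) = sides r z [:: e] (+) sides r z P.
Proof. by rewrite /sides big_cons big_seq1. Qed.

Lemma sides_cat r z P Q : sides r z (P ++ Q) = sides r z P (+) sides r z Q.
Proof. by rewrite /sides big_cat. Qed.

(** Sum of [disjoint_segments] for [e] against each edge of [P]: the [downward] tests at the inner
    vertices of [P] cancel in pairs. *)
Lemma sides_shift e f P : path follows f P ->
  {in P, forall g, eseg e `&` eseg g = set0} ->
  sides upward (pos (src e)) P (+) sides upward (pos (tgt e)) P
  = sides downward (pos (tgt f)) [:: e] (+) sides downward (pos (tgt (last f P))) [:: e].
Proof.
elim: P f => [|g P IH] f /=; first by rewrite addbb /sides !big_nil.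
move=> /andP[/eqP fg gP] disj.
rewrite !(sides_cons upward _ g P) addbACA (IH g) //; last first.
  by move=> x xP; apply: disj; rewrite inE xP orbT.
have -> : sides upward (pos (src e)) [:: g] (+) sides upward (pos (tgt e)) [:: g]
    = sides downward (pos (tgt f)) [:: e] (+) sides downward (pos (tgt g)) [:: e].
  rewrite /sides !big_seq1 fg; apply: disjoint_segments.
  - exact: edge_nonvertical.
  - exact: edge_nonvertical.
  - by apply: coord_disjoint; apply: disj; exact: mem_head.
by do 3!case: sides.
Qed.

Hypothesis acyc : acyclic N.

(* Modulo 2, the tangent vector turns through the vertical as often as the secant
   which first joins the start of the path to a moving point and then a moving
   point to the end of the path. *)
Lemma wind_parity e P : path follows e P ->
  odd (absz (wind l (e :: P)))
  = sides downward (pos (tgt (last e P))) (belast e P)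
    (+) sides upward (pos (src e)) P.
Proof.
elim: P e => [|f P IH] e; first by rewrite wind1 /sides !big_nil.
move=> eP; move: (eP) => /= /andP[ef fP].
rewrite wind_cons odd_abszD IH // odd_wind2 //= (sides_cons _ _ e (belast f P)).
rewrite (sides_cons upward _ f P).
(* Moving the base point of the secants from [tgt e] to [src e] changes the [upward] terms, and
   [sides_shift] turns this change into [downward] tests against [e]. *)
have := sides_shift e f P fP (acyclic_edges_disjoint N acyc e f P ^~ eP).
move: ef => /eqP ->; move: (sides downward _ (belast f P)).
by move=> []; do 5!case: sides.
Qed.

Lemma path_parity e S S' h :
  path follows e (rcons S h) -> path follows e (rcons S' h) ->
  forall j, tgt h = inl j ->
  odd (absz (wind l (e :: rcons S h) + (int_path l (e :: rcons S h))%:Z))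
  = odd (absz (wind l (e :: rcons S' h) + (int_path l (e :: rcons S' h))%:Z)).
Proof.
move=> eS eS' j hj; rewrite !odd_abszD !absz_nat (int_path_parity e S S' h) //.
congr (_ (+) _).
(* The common prefix makes the base point of the [upward] tests a boundary vertex, as [sides_eq]
   requires. *)
have [e0 [B [i [e0B lB se0]]]] := path_from_source N acyc e.
(* Only the two tests on [X], from [b_j] and from [b_i], depend on the inner edges. *)
have wB X : path follows e (rcons X h) ->
  odd (absz (wind l (e :: rcons X h))) = odd (absz (wind l (e0 :: B)))
  (+) (sides downward (bd j) (belast e0 B) (+) sides downward (bd j) [:: e]
       (+) sides downward (bd j) X)
  (+) (sides upward (bd i) B (+) sides upward (bd i) X (+) sides upward (bd i) [:: h]).
  move=> eX.
  have p : path follows e0 (B ++ rcons X h) by rewrite cat_path e0B lB.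
  have := wind_parity _ _ p; rewrite wind_cat lB odd_abszD.
  rewrite belast_cat lB belast_rcons last_cat lB last_rcons hj se0.
  rewrite !sides_cat (sides_cons _ _ e X) -cats1 sides_cat.
  by do 6!case: sides; case: odd; case: odd.
rewrite !wB //.
by rewrite !(sides_eq _ _ e S S' h) //; tauto.
Qed.

End Parity.

(** * Edge vectors *)

Section EdgeVectors.
Context {R : realType} {k n : nat} (N : plabic_network R k n) (l : R * R).
Hypothesis gauge : gauge_ray_direction N l.
Hypothesis acyc : acyclic N.
Implicit Types (e : edge N) (F : seq (edge N)) (j : 'I_n).

Let parity F := odd (absz (wind l F + (int_path l F)%:Z)).

Lemma parity_paths e j F F' : paths e j F -> paths e j F' -> parity F = parity F'.
Proof.
case: F => [|f P] [] //= [->] eP tP; case: F' => [|f' P'] [] //= [->] eP' tP'.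
(* If one path is reduced to [e], then [e] ends at [b_j] and no edge can follow it. Otherwise both
   paths arrive by the unique edge at [b_j]. *)
case/lastP: P eP tP => [|S h] eP tP; case/lastP: P' eP' tP' => [|S' h'] eP' tP' //.
- case: S' eP' {tP'} => [|g S'] /= /andP[/(follows_internal N _ _ j)[]] //.
- case: S eP {tP} => [|g S] /= /andP[/(follows_internal N _ _ j)[]] //.
rewrite !last_rcons in tP tP'.
have hh' := boundary_sink_unique N _ _ _ tP tP'.
rewrite -hh' in eP' *.
exact: (path_parity N l gauge acyc e S S' h eP eP' j tP).
Qed.

Lemma paths_source e j : j \in sources N -> paths e j = set0.
Proof.
rewrite inE => /eqP out1; rewrite -subset0 => F [_ _ tF].
have /card_gt0P[g] : (0 < out_degree (G := N) (inl j))%N by rewrite out1.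
by rewrite inE => /eqP sg; exact: (boundary_not_inner N _ g j tF sg).
Qed.

(** By [parity_paths] this is the common parity of all paths from [e] to [b_j]; it is [false] if
    there is none. *)
Definition path_sign e j : bool := `[< exists F, paths e j F /\ parity F >].

Lemma path_signE e j F : paths e j F -> parity F = path_sign e j.
Proof.
move=> eF; apply/idP/asboolP => [pF|[F' [eF' pF']]]; first by exists F.
by rewrite (parity_paths e j F F').
Qed.

Lemma exprN1z (z : int) : (-1 : R) ^ z = (-1) ^+ odd (absz z).
Proof.
case: z => m; first by rewrite -exprnP signr_odd.
by rewrite NegzE -exprnN -exprVn invrN1 abszN absz_nat signr_odd.
Qed.

Lemma signed_sum e j :
  \sum_(F \in paths e j) (-1) ^ (wind l F + (int_path l F)%:Z) * path_weight F
  = (-1) ^+ path_sign e j * \sum_(F \in paths e j) path_weight F :> R.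
Proof.
rewrite mulr_fsumr; apply: eq_fsbigr => F; rewrite inE => eF.
by rewrite exprN1z -/(parity F) (path_signE e j).
Qed.

(** The components at boundary sources vanish because no path ends there. *)
Lemma edge_vector_delta e (c : 'I_n -> R) :
  (forall j, edge_vector l e 0 j = c j) ->
  edge_vector l e = \sum_(j | j \notin sources N) c j *: delta_mx 0 j.
Proof.
move=> hc; rewrite [LHS]row_sum_delta (bigID (fun j => j \in sources N)) /=.
rewrite big1 ?add0r; first by apply: eq_bigr => j _; rewrite hc.
by move=> j sj; rewrite mxE paths_source // fsbig_set0 scale0r.
Qed.

(** Some path leads from [e] to a sink [b_j]; all terms of that component have the same sign and
    nonzero absolute value, so they cannot cancel. *)
Lemma edge_vector_neq0 e : edge_vector l e <> 0.
Proof.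
have [P [j [eP tP]]] := path_to_sink N acyc e.
have pj : paths e j (e :: P) by [].
move=> /rowP /(_ j); rewrite !mxE signed_sum => /eqP.
rewrite mulf_eq0 signr_eq0 /= => /eqP sum0.
have wpos F : 0 < path_weight (N := N) F by apply: prodr_gt0 => g _; exact: weight_gt0.
have fin := finite_paths N acyc e j.
have := pfsumr_eq0 fin (fun F _ => ltW (wpos F)) sum0 pj.
by move/eqP; rewrite gt_eqF.
Qed.

End EdgeVectors.

(** * Acyclicity of Le-networks *)

Lemma ranked_acyclic (R : realType) (k n : nat) (N : plabic_graph R k n)
    (rank : ivertex N -> nat) :
  (forall e u v, src e = inr u -> tgt e = inr v -> (rank u < rank v)%N) ->
  acyclic N.
Proof.
move=> inc e P eP loop.
(* A directed cycle cannot pass through a boundary vertex, so the rank would increase strictly all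
   around it. *)
have step f Q v : path (@follows R n N) f Q -> tgt (last f Q) = inr v ->
    exists2 u, tgt f = inr u & (rank u <= rank v)%N.
  elim: Q f => [|g Q IH] f /=; first by exists v.
  move=> /andP[/eqP fg gQ] /(IH _ gQ)[u tg uv].
  case tf: (tgt f) fg => [i|w] fg.
    have [+ _] := follows_internal N f g i (introT eqP (etrans tf fg)).
    by rewrite tf.
  by exists w => //; apply: leq_trans uv; apply: ltnW; exact: (inc g).
case se: (src e) => [i|v].
  by apply: (boundary_not_inner N (last e P) e i _ se); rewrite loop.
have [u te uv] := step e P v eP (etrans loop se).
by have := inc e v u se te; rewrite ltnNge uv.
Qed.

Lemma le_network_acyclic (R : realType) (k n : nat) (N : plabic_network R k n) :
  le_network N -> acyclic N.
Proof.
move=> [L [fV [fE [[gV fVK gVK] [gE fEK gEK] srcE tgtE]]]].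
(* Moving left or down raises the second summand by at least 2, which outweighs the loss of the bit;
   a middle edge raises only the bit. *)
pose rk (v : le_vertex L) : nat :=
  (((val v).2 : nat) + 2 * (le_row (val v).1 + (n - k - le_col (val v).1)))%N.
apply: (ranked_acyclic _ _ _ N (fun v => rk (gV v))) => e u v.
rewrite -(gEK e) srcE tgtE; move: (gE e) => {}e.
have hb (b : le_box L) : (le_col b < n - k)%N by exact: ltn_ord.
case: e => [b|b|b] /=.
- rewrite /next_right; case: pickP => // b' /andP[/andP[/eqP r c] _] [<-] [<-].
  rewrite !fVK /rk /= r; have := hb b; have := hb b'; move: c.
  by case: four_valent; lia.
- rewrite /next_below; case: pickP => // b' /andP[/andP[/eqP c r] _] [<-] [<-].
  rewrite !fVK /rk /= c; move: r.
  by case: four_valent; lia.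
- by move=> [<-] [<-]; rewrite !fVK /rk /= (valP b).
Qed.

Theorem theorem7p1 (R : realType) (k n : nat) (k_gt0 : (0 < k)%N) (k_ltn : (k < n)%N) :
  (forall (N : plabic_network R k n) (l : R * R)
          (M : {set {set 'I_n}}) (A : 'M[R]_(k, n)),
     acyclic N -> no_internal_source N -> no_internal_sink N ->
     gauge_ray_direction N l ->
     matroid (k := k) M -> irreducible_cell M -> positroid_cell M A ->
     represents N A ->
     (forall e : edge N, edge_vector l e <> 0) /\
     exists sigma : edge N -> 'I_n -> bool,
       (forall (e : edge N) (j : 'I_n) (F : seq (edge N)),
          j \notin sources N -> paths e j F ->
          odd (absz (wind l F + (int_path l F)%:Z)) = sigma e j) /\
       (forall e : edge N,
          edge_vector l e =
            \sum_(j | j \notin sources N)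
               (\sum_(F \in paths e j)
                  (-1) ^ (wind l F + (int_path l F)%:Z) * path_weight F)
               *: delta_mx 0 j
          /\
          edge_vector l e =
            \sum_(j | j \notin sources N)
               ((-1) ^+ sigma e j * \sum_(F \in paths e j) path_weight F)
               *: delta_mx 0 j))
  /\
  (forall (N : plabic_network R k n) (l : R * R)
          (M : {set {set 'I_n}}) (A : 'M[R]_(k, n)),
     le_network N ->
     gauge_ray_direction N l ->
     matroid (k := k) M -> irreducible_cell M -> positroid_cell M A ->
     represents N A ->
     exists sigma : edge N -> 'I_n -> bool,
       (forall (e : edge N) (j : 'I_n) (F : seq (edge N)),
          j \notin sources N -> paths e j F ->
          odd (absz (wind l F + (int_path l F)%:Z)) = sigma e j) /\
       (forall e : edge N,
          edge_vector l e =
            \sum_(j | j \notin sources N)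
               (\sum_(F \in paths e j)
                  (-1) ^ (wind l F + (int_path l F)%:Z) * path_weight F)
               *: delta_mx 0 j
          /\
          edge_vector l e =
            \sum_(j | j \notin sources N)
               ((-1) ^+ sigma e j * \sum_(F \in paths e j) path_weight F)
               *: delta_mx 0 j)).
Proof.
have main (N : plabic_network R k n) (l : R * R) : acyclic N ->
    gauge_ray_direction N l ->
    exists sigma : edge N -> 'I_n -> bool,
      (forall (e : edge N) (j : 'I_n) (F : seq (edge N)),
         j \notin sources N -> paths e j F ->
         odd (absz (wind l F + (int_path l F)%:Z)) = sigma e j) /\
      (forall e : edge N,
         edge_vector l e =
           \sum_(j | j \notin sources N)
              (\sum_(F \in paths e j)
                 (-1) ^ (wind l F + (int_path l F)%:Z) * path_weight F)
              *: delta_mx 0 j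
         /\
         edge_vector l e =
           \sum_(j | j \notin sources N)
              ((-1) ^+ sigma e j * \sum_(F \in paths e j) path_weight F)
              *: delta_mx 0 j).
  (* The first formula is the definition of the edge vector; the second takes the common sign out of
     the sum. *)
  move=> acyc gauge; exists (path_sign N l); split=> [e j F _|e].
    exact: path_signE.
  split; apply: edge_vector_delta => j; rewrite mxE //.
  exact: signed_sum.
split=> N l M A.
  move=> acyc _ _ gauge _ _ _ _; split; last exact: main.
  exact: edge_vector_neq0.
by move=> /le_network_acyclic acyc gauge _ _ _ _; exact: main.
Qed.
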